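(* Let $K\subset\mathbb{R}^n$ be compact, smoothly path-connected, and strictly forward invariant under $\dot x=f(x)$, with Jacobian $A(x)=\frac{\partial f}{\partial x}(x)$. Suppose there exist a constant $\lambda>0$ and a Finsler function $V(x,\delta_x)$, defined for $x\in K$, $\delta_x\in\mathbb{R}^n$, such that $$\frac{\partial V}{\partial x}(x,\delta_x)\,f(x)+\frac{\partial V}{\partial\delta_x}(x,\delta_x)\,A(x)\,\delta_x\le-\lambda V(x,\delta_x)$$ for all $x\in K$ and all $\delta_x\neq0$ such that $\frac{\partial V}{\partial\delta_x}(x,\delta_x)f(x)=0$. Then all solutions starting with $x(0)\in K$ converge to a unique limit cycle (possibly trivial, i.e. an equilibrium): there is a unique periodic orbit $\mathcal{X}^\star\subset K$ such that for every solution with $x(0)\in K$ the distance from $x(t)$ to $\mathcal{X}^\star$ tends to $0$ as $t\to\infty$.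
   Context: The system is the autonomous ODE $\dot x=f(x)$, $x\in\mathbb{R}^n$, with $f:K\to\mathbb{R}^n$ smooth and solutions existing and unique. A set $K$ is strictly forward invariant under $f$ if any solution with $x(0)\in K$ is in the interior of $K$ for all $t>0$. $K$ is smoothly path-connected if any two points of $K$ are joined by a smooth path remaining in $K$. A periodic solution $x^\star$ is one for which there is $T>0$ with $x^\star(t)=x^\star(t+T)$ for all $t$ (equilibria are trivially periodic); its orbit is $\mathcal{X}^\star=\{x: x=x^\star(t)\text{ for some }t\}$. A Finsler function $V(x,\delta_x)$ is a Finsler metric in the standard sense: continuous, smooth where $\delta_x\ne0$, positive for $\delta_x\neq0$, positively homogeneous of degree one in $\delta_x$, and strongly convex in $\delta_x$ (the Hessian of $\frac12V^2$ in $\delta_x$ is positive definite for $\delta_x\neq0$). The principal example is $V(x,\delta_x)=\sqrt{\delta_x'M(x)\delta_x}$ with $M(x)$ symmetric positive definite and smooth in $x$; a prime denotes transpose. *)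

(* Defs.v *)
(* MathComp-Analysis.  Points and tangent vectors of R^n are row vectors, so
   that the library Jacobian 'J f x acts on the right: the product of the
   Jacobian with a tangent vector d is  d *m 'J f x.  The library norm on 'rV_n
   is the sup norm, which is equivalent to the Euclidean one. *)
From mathcomp Require Import all_boot all_order all_algebra.
From mathcomp Require Import all_classical all_reals all_analysis.

Set Implicit Arguments.
Unset Strict Implicit.
Unset Printing Implicit Defensive.

Import Order.TTheory GRing.Theory Num.Theory.
Import numFieldNormedType.Exports.

Local Open Scope classical_set_scope.
Local Open Scope ring_scope.

(* C^oo on an arbitrary set A, i.e. on some open neighbourhood U of A.
   Functions below are total; for a function only given on A this says that it
   is the restriction of a smooth function defined around A.  The iterated
   directional derivatives are required to be Frechet differentiable on U,
   hence are also continuous there. *)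
Definition smooth (R : realType) (E F : normedModType R) (A : set E)
    (f : E -> F) : Prop :=
  exists U : set E, [/\ open U, A `<=` U &
    forall (vs : seq E) (x : E), U x ->
      differentiable (foldr (fun v (g : E -> F) => 'D_v g) f vs) x].

Section Dynamics.
Context {R : realType} {n : nat}.
Implicit Types (K X : set 'rV[R]_n) (f : 'rV[R]_n -> 'rV[R]_n).

Definition smoothly_path_connected K : Prop :=
  forall a b, K a -> K b ->
    exists g : R -> 'rV[R]_n,
      [/\ smooth (`[0, 1] : set R) g, g 0 = a, g 1 = b & forall s : R, 0 <= s <= 1 -> K (g s)].

(* Solution of x' = f(x) on an interval J.  At an endpoint of J only (one-sided)
   continuity is required; the one-sided differential equation follows when f
   is continuous. *)
Definition solution f (J : set R) (x : R -> 'rV[R]_n) : Prop :=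
  {within J, continuous x} /\
  forall t : R, J° t -> is_derive t (1 : R) x (f (x t)).

(* Quantifying over solutions on [0, T[ for every T also covers solutions that
   are not defined for all t >= 0. *)
Definition strictly_forward_invariant f K : Prop :=
  forall (T : R) (x : R -> 'rV[R]_n), solution f `[0, T[ x -> K (x 0) ->
    forall t : R, 0 < t < T -> K° (x t).

Definition solutions_exist_unique f K : Prop :=
  (forall a, K a -> exists x, solution f `[0, +oo[ x /\ x 0 = a) /\
  (forall (T : R) (x y : R -> 'rV[R]_n),
     solution f `[0, T[ x -> solution f `[0, T[ y -> K (x 0) -> x 0 = y 0 ->
     forall t : R, 0 <= t < T -> x t = y t).

(* An equilibrium {a} is a periodic orbit. *)
Definition periodic_orbit f X : Prop :=
  exists (x : R -> 'rV[R]_n) (T : R),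
    [/\ solution f setT x, 0 < T, forall t, x (t + T) = x t & X = range x].

Definition hessian (g : 'rV[R]_n -> R) (d : 'rV[R]_n) : 'M[R]_n :=
  \matrix_(i, j) 'D_(delta_mx 0 i) ('D_(delta_mx 0 j) g) d.

Definition positive_definite (M : 'M[R]_n) : Prop :=
  M^T = M /\ forall v : 'rV[R]_n, v != 0 -> 0 < (v *m M *m v^T) 0 0.

Record finsler_metric K (V : 'rV[R]_n -> 'rV[R]_n -> R) : Prop := {
  finsler_continuous :
    {within K `*` setT, continuous (fun p : 'rV[R]_n * 'rV[R]_n => V p.1 p.2)};
  finsler_smooth :
    smooth (K `*` [set d | d != 0])
      (fun p : 'rV[R]_n * 'rV[R]_n => V p.1 p.2);
  finsler_pos : forall x d : 'rV[R]_n, K x -> d != 0 -> 0 < V x d;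
  finsler_homogeneous :
    forall (x d : 'rV[R]_n) (c : R), K x -> 0 < c -> V x (c *: d) = c * V x d;
  finsler_strongly_convex : forall x d : 'rV[R]_n, K x -> d != 0 ->
    positive_definite (hessian (fun e => 2^-1 * V x e ^+ 2) d)
}.

Definition transverse_contraction f K (V : 'rV[R]_n -> 'rV[R]_n -> R)
    (lambda : R) : Prop :=
  forall x d : 'rV[R]_n, K x -> d != 0 -> 'd (V x) d (f x) = 0 ->
    'd (V^~ d) x (f x) + 'd (V x) d (d *m 'J f x) <= - lambda * V x d.

End Dynamics.

(* Main.v *)
From HB Require Import structures.
Require Import Defs.
From mathcomp Require Import all_boot all_order all_algebra.
From mathcomp Require Import all_classical all_reals all_analysis.
From mathcomp Require Import ring lra.
Set Implicit Arguments.
Unset Strict Implicit.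
Unset Printing Implicit Defensive.
Import Order.TTheory GRing.Theory Num.Theory.
Import numFieldNormedType.Exports.
Local Open Scope classical_set_scope.
Local Open Scope ring_scope.

(** The contraction hypothesis controls a displacement only when it is
    transverse to the flow in the sense of [V], so two solutions x and y can be
    compared only after their clocks have been adjusted.  Let w(t) be the minimum
    of V (x t) (y (t + th) - x t) over a small window of time offsets th.  At a
    minimising offset inside the window, the derivative of [V] in its second
    argument vanishes in the direction f (y (t + th)): up to an error that
    disappears with the displacement, this is the transversality that the
    hypothesis asks for.  Keeping that offset fixed for a short time bounds w from
    above, so w decays like exp (- (lambda / 2) t) as long as the displacement is
    small.  [local_contraction] is the differential inequality for small finite
    displacements, and [minimal_decay] integrates it for a minimum over a compact
    window.  The minimum is attained inside the window when the speed is bounded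
    below along x, because a shift of the clock then shows up as a displacement
    ([flow_escape]); when x is an equilibrium every displacement is transverse and
    the offset 0 is enough.  The outcome is [synchronised_step]: after some time
    T, and after a change of the clock of y by an amount proportional to the
    initial distance, the distance between x and y has been halved.

    Repeating this step gives the theorem.  If the orbit of a point p of [K]
    comes arbitrarily close to equilibria, its closure contains one.  Otherwise
    its speed is bounded below.  By compactness the orbit comes back close to
    some earlier point x after a time S >= 2; synchronising the solution that
    starts at phi x S with the one that starts at x produces points of the orbit
    that return closer and closer to themselves, after times that stay within
    distance 1 of S, and compactness turns them into a periodic point
    ([periodic_in_closure]).  In both cases the periodic point attracts all
    nearby points, again by repeated steps ([regular_attracts]), and the orbit of
    p enters its neighbourhood.  Hence every point of [K] has a neighbourhood that
    is attracted to a single periodic orbit ([local_attractor]).  A point cannot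
    be attracted to two different periodic orbits ([common_limit]), so the
    attracting orbit is constant along paths ([attracted_along_path]), and
    therefore the same for all points of [K].  A periodic orbit in [K] is
    attracted to it as well, and a periodic solution can only approach an orbit
    that contains it: this is uniqueness. *)

(** * Curves of row vectors *)

Section RowVectors.
Context {R : realType} {n : nat}.
Implicit Types v : 'rV[R]_n.

Lemma row_norm_le v (r : R) : 0 <= r -> (forall i, `|v 0 i| <= r) -> `|v| <= r.
Proof.
move=> r0 vr; rewrite [leLHS]/Num.norm /= mx_normrE; apply/bigmax_leP; split => //.
by move=> [i j] _ /=; rewrite ord1.
Qed.

Lemma coord_norm_le v i : `|v 0 i| <= `|v|.
Proof.
rewrite [leRHS]/Num.norm /= mx_normrE.
by apply/bigmax_geP; right; exists (0, i).
Qed.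

Lemma continuous_coord (T : topologicalType) (x : T -> 'rV[R]_n) i t :
  {for t, continuous x} -> {for t, continuous (fun s => x s 0 i)}.
Proof.
move=> cx; apply: (@continuous_comp _ _ _ x (fun v : 'rV[R]_n => v 0 i)) => //.
exact: coord_continuous.
Qed.

Lemma is_derive_coord (x : R -> 'rV[R]_n) (d : 'rV[R]_n) (t : R) i :
  is_derive t 1 x d -> is_derive t 1 (fun s => x s 0 i) (d 0 i).
Proof.
move=> [dx <-]; rewrite derive_mx // mxE.
by apply: derivableP; move/derivable_mxP: dx; apply.
Qed.

Lemma coord_MVT (x dx : R -> 'rV[R]_n) (a b : R) i : a < b ->
  (forall t, a < t < b -> is_derive t 1 x (dx t)) ->
  {within `[a, b], continuous x} ->
  exists2 c, a < c < b & (x b - x a) 0 i = dx c 0 i * (b - a).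
Proof.
move=> ab xd xc; have := @MVT R (fun s => x s 0 i) (fun s => dx s 0 i) a b ab.
case.
- by move=> t; rewrite in_itv/= => tab; apply: is_derive_coord; exact: xd.
- by move=> t; apply: continuous_coord; exact: xc.
- by move=> c; rewrite in_itv/= => cab e; exists c => //; rewrite !mxE.
Qed.

(** With the sup norm the mean value theorem may be applied to one coordinate at
    a time, at no loss in the constant. *)
Lemma path_lipschitz (x dx : R -> 'rV[R]_n) (a b M : R) : a <= b ->
  (forall t, a < t < b -> is_derive t 1 x (dx t)) ->
  {within `[a, b], continuous x} ->
  (forall t, a < t < b -> `|dx t| <= M) -> `|x b - x a| <= M * (b - a).
Proof.
rewrite le_eqVlt => /predU1P[->|ab] xd xc xM; first by rewrite !subrr mulr0 normr0.
have M0 : 0 <= M.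
  by apply: le_trans (xM ((a + b) / 2) _); [exact: normr_ge0|rewrite !midf_lt].
apply: row_norm_le => [|i]; first by rewrite mulr_ge0// subr_ge0 ltW.
have [c cab ->] := coord_MVT i ab xd xc.
have ba : 0 <= b - a by rewrite subr_ge0 ltW.
rewrite normrM (ger0_norm ba); apply: ler_wpM2r => //; apply: le_trans (xM _ cab).
exact: coord_norm_le.
Qed.

End RowVectors.

(** * Differential calculus along lines *)

Section Calculus.
Context {R : realType}.

Lemma is_derive_diff_comp (E F : normedModType R) (g : E -> F) (x : R -> E)
    (t : R) (d : E) :
  is_derive t 1 x d -> differentiable g (x t) ->
  is_derive t 1 (g \o x) ('d g (x t) d).
Proof.
move=> [dx <-] dg.
have dx' : differentiable x t by exact/derivable1_diffP.
have dgx : differentiable (g \o x) t by exact: differentiable_comp.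
split; first exact: diff_derivable.
by rewrite deriveE // diff_comp //= deriveE.
Qed.

Lemma is_derive_line (E : normedModType R) (a v : E) (t : R) :
  is_derive t 1 (fun s : R => a + s *: v) v.
Proof.
have dZ : differentiable (fun s : R => s *: v) t by [].
have hZ : is_derive t 1 (fun s : R => s *: v) v.
  split; first exact/derivable1_diffP.
  by rewrite deriveE // diff_val scale1r.
have := is_deriveD (is_derive_cst a t (1 : R)) hZ.
by rewrite add0r.
Qed.

Lemma is_derive_shiftl (E : normedModType R) (x : R -> E) (s t : R) (d : E) :
  is_derive (s + t) 1 x d -> is_derive t 1 (fun u => x (s + u)) d.
Proof.
move=> xst; have dx : differentiable x (s + t) by apply/derivable1_diffP.
have dl : is_derive t (1 : R) (fun u : R => s + u *: (1 : R)) (1 : R) by exact: is_derive_line.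
have tE : s + t *: (1 : R) = s + t by rewrite [t *: 1]mulr1.
have := is_derive_diff_comp dl; rewrite tE => /(_ _ x dx).
rewrite -(deriveE _ dx); have [_ ->] := xst.
by congr is_derive; apply/funext => u /=; rewrite [u *: 1]mulr1.
Qed.

Lemma is_derive_pair (E F : normedModType R) (x : R -> E) (y : R -> F) (t : R)
    (dx : E) (dy : F) :
  is_derive t 1 x dx -> is_derive t 1 y dy ->
  is_derive t 1 (fun s => (x s, y s)) (dx, dy).
Proof.
move=> [x1 <-] [y1 <-].
have x2 : differentiable x t by exact/derivable1_diffP.
have y2 : differentiable y t by exact/derivable1_diffP.
have xy := differentiable_pair x2 y2.
split; first exact/derivable1_diffP.
by rewrite deriveE // diff_pair //= !deriveE.
Qed.

Lemma neg_derive_right (q : R -> R) (t d : R) :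
  is_derive t 1 q d -> d < 0 -> \forall s \near t^'+, q s < q t.
Proof.
move=> [dq <-] d0; move/cvgr_lt : (dq) => /(_ _ d0).
rewrite -/(at_right t) !near_withinE => /nbhs_ballP[e /= e0 eP].
apply/nbhs_ballP; exists e => //= s; rewrite -ball_normE /= => st ts.
have := eP (s - t); rewrite -ball_normE /= sub0r normrN distrC.
rewrite st subr_eq0 gt_eqF // => /(_ isT isT).
rewrite [_%:A]mulr1 subrK pmulr_rlt0 ?invr_gt0 ?subr_gt0 //.
by rewrite subr_lt0.
Qed.

(** Fermat's rule at a single point, where the function need not be
    differentiable anywhere else. *)
Lemma local_min_derive (q : R -> R) (t d : R) :
  is_derive t 1 q d -> (\forall s \near t, q t <= q s) -> d = 0.
Proof.
move=> qd qmin; apply/eqP; rewrite eq_le; apply/andP; split; rewrite leNgt; apply/negP => d0.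
  have qd' : is_derive (- - t) 1 q d by rewrite opprK.
  have qN := is_derive1_comp qd' (is_deriveNid (- t) (1 : R)).
  have dN : d * -1 < 0 by rewrite mulrN1 oppr_lt0.
  have /nearN qmin' : \forall s \near - - t, q t <= q s by rewrite opprK.
  have [s [h1 h2]] : exists s, q (- s) < q (- - t) /\ q t <= q (- s).
    apply: (@filter_ex _ ((- t)^'+)); apply: filterI; first exact: neg_derive_right qN dN.
    exact: cvg_within qmin'.
  by move: h1; rewrite opprK ltNge h2.
have [s [h1 h2]] : exists s, q s < q t /\ q t <= q s.
  apply: (@filter_ex _ (t^'+)); apply: filterI; first exact: neg_derive_right qd d0.
  exact: cvg_within qmin.
by move: h1; rewrite ltNge h2.
Qed.

Lemma smooth_differentiable (E F : normedModType R) (A : set E) (g : E -> F) x :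
  smooth A g -> A x -> \forall y \near x, differentiable g y.
Proof.
move=> [U [oU AU dg]] Ax; have Ux : nbhs x U by apply: open_nbhs_nbhs; split=> //; exact: AU.
by apply: filterS Ux => y Uy; exact: (dg [::]).
Qed.

Lemma smooth_continuous_derive (E F : normedModType R) (A : set E) (g : E -> F)
    x (v : E) :
  smooth A g -> A x -> {for x, continuous ('D_v g)}.
Proof.
move=> [U [oU AU dg]] Ax; apply: differentiable_continuous.
by apply: (dg [:: v]); exact: AU.
Qed.

Lemma linear_row (n : nat) (F : normedModType R) (g : 'rV[R]_n -> F)
    (v : 'rV[R]_n) :
  linear g -> g v = \sum_i v 0 i *: g (delta_mx 0 i).
Proof.
move=> gl; pose gL : {linear 'rV[R]_n -> F} :=
  HB.pack g (GRing.isLinear.Build _ _ _ _ g gl).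
rewrite -[g]/(gL : _ -> _) {1}[v]row_sum_delta linear_sum.
by apply: eq_bigr => i _; rewrite linearZ.
Qed.

(** Two linear maps that are close on a basis are close in operator norm.  The
    number of basis vectors is absorbed by [n.+1], which is never zero. *)
Lemma linear_near (n : nat) (F : normedModType R) (g h : 'rV[R]_n -> F) (e : R) :
  linear g -> linear h ->
  (forall i, `|g (delta_mx 0 i) - h (delta_mx 0 i)| <= e / n.+1%:R) ->
  0 <= e -> forall v, `|g v - h v| <= e * `|v|.
Proof.
move=> gl hl gh e0 v; rewrite (linear_row v gl) (linear_row v hl) -sumrB.
apply: (@le_trans _ _ (\sum_(i < n) (`|v| * (e / n.+1%:R)))).
  apply: le_trans (ler_norm_sum _ _ _) _; apply: ler_sum => i _.
  rewrite -scalerBr normrZ; apply: ler_pM => //; exact: coord_norm_le.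
rewrite sumr_const card_ord -[_ *+ n]mulr_natr.
have -> : `|v| * (e / n.+1%:R) * n%:R = e * (n%:R / n.+1%:R) * `|v| by ring.
apply: ler_wpM2r; first exact: normr_ge0.
rewrite -[leRHS]mulr1; apply: ler_wpM2l => //.
by rewrite ler_pdivrMr // mul1r ler_nat.
Qed.

(** Smoothness is stated through directional derivatives; this is the step
    towards continuity of the differential. *)
Lemma near_derive_smooth (E F : normedModType R) (A : set E) (g : E -> F)
    (I : finType) (b : I -> E) x0 (e : R) : smooth A g -> A x0 -> 0 < e ->
  \forall x \near x0, differentiable g x /\
    forall i, `|'d g x (b i) - 'd g x0 (b i)| <= e.
Proof.
move=> gs Ax e0.
have dgx := smooth_differentiable gs Ax.
have dx0 : differentiable g x0 := nbhs_singleton dgx.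
have H : \forall x \near x0, forall i, `|'D_(b i) g x - 'D_(b i) g x0| <= e.
  apply: (@filter_forall _ I _ (nbhs x0)) => i.
  have /cvgrPdist_le/(_ _ e0) := smooth_continuous_derive (v := b i) gs Ax.
  by apply: filterS => y h; rewrite distrC; exact: h.
apply: filterS2 dgx H => x dx H; split => // i.
have -> : 'd g x (b i) - 'd g x0 (b i) = 'D_(b i) g x - 'D_(b i) g x0.
  by congr (_ - _); apply/esym/deriveE.
exact: H.
Qed.

Lemma near_diff_smooth (n : nat) (F : normedModType R) (A : set 'rV[R]_n)
    (g : 'rV[R]_n -> F) x0 (e : R) : smooth A g -> A x0 -> 0 < e ->
  \forall x \near x0, differentiable g x /\
    forall v, `|'d g x v - 'd g x0 v| <= e * `|v|.
Proof.
move=> gs Ax e0; have e1 : 0 < e / n.+1%:R by rewrite divr_gt0.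
have := near_derive_smooth (fun i : 'I_n => delta_mx 0 i : 'rV[R]_n) gs Ax e1.
apply: filterS => x [dx H]; split => // v.
by apply: linear_near (ltW e0) v => //; exact: linearP.
Qed.

Lemma near_diff_smooth_prod (n : nat) (F : normedModType R)
    (A : set ('rV[R]_n * 'rV[R]_n)) (g : 'rV[R]_n * 'rV[R]_n -> F) x0 (e : R) :
  smooth A g -> A x0 -> 0 < e ->
  \forall x \near x0, differentiable g x /\
    forall v w, `|'d g x (v, w) - 'd g x0 (v, w)| <= e * (`|v| + `|w|).
Proof.
move=> gs Ax e0; have e1 : 0 < e / n.+1%:R by rewrite divr_gt0.
have := near_derive_smooth (fun k : 'I_n + 'I_n => match k with
  | inl i => (delta_mx 0 i, 0) | inr i => (0, delta_mx 0 i) end : 'rV[R]_n * 'rV[R]_n) gs Ax e1.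
apply: filterS => x [dx H]; split => // v w.
have split z : 'd g z (v, w) = 'd g z (v, 0) + 'd g z (0, w).
  by rewrite -linearD; congr ('d g z _); congr pair; rewrite ?addr0 ?add0r.
have l1 z : linear (fun u : 'rV[R]_n => 'd g z (u, 0)).
  move=> k u1 u2 /=; rewrite -linearP; congr ('d g z _).
  by congr pair; rewrite /= scaler0 addr0.
have l2 z : linear (fun u : 'rV[R]_n => 'd g z (0, u)).
  move=> k u1 u2 /=; rewrite -linearP; congr ('d g z _).
  by congr pair; rewrite /= scaler0 addr0.
have h1 := linear_near (l1 x) (l1 x0) (fun i => H (inl i)) (ltW e0) v.
have h2 := linear_near (l2 x) (l2 x0) (fun i => H (inr i)) (ltW e0) w.
have -> : 'd g x (v, w) - 'd g x0 (v, w) = ('d g x (v, 0) - 'd g x0 (v, 0)) +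
    ('d g x (0, w) - 'd g x0 (0, w)).
  transitivity (('d g x (v, 0) + 'd g x (0, w)) - ('d g x0 (v, 0) + 'd g x0 (0, w))).
    by congr (_ - _); exact: split.
  by rewrite opprD addrACA.
by apply: le_trans (ler_normD _ _) _; rewrite mulrDr; exact: lerD.
Qed.

Section StrictDifferentiability.
Context {n : nat}.
Variables (A : set 'rV[R]_n) (f : 'rV[R]_n -> 'rV[R]_n).
Hypothesis fs : smooth A f.

(** The map y |-> f y - 'd f x0 y has a small differential near x0, so it is
    Lipschitz with a small constant on a ball, by the mean value inequality on
    segments. *)
Lemma strict_differentiability x0 (e : R) : A x0 -> 0 < e ->
  exists2 r : R, 0 < r & forall x y, `|x - x0| < r -> `|y - x0| < r ->
    `|f y - f x - 'd f x0 (y - x)| <= e * `|y - x|.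
Proof.
move=> Ax e0.
have /nbhs_ballP[r /= r0 rP] : nbhs x0 [set x | differentiable f x /\
    forall v, `|'d f x v - 'd f x0 v| <= e * `|v|].
  exact: near_diff_smooth fs Ax e0.
 exists r => // x y xr yr.
pose p : R -> 'rV[R]_n := fun t => x + t *: (y - x).
have dp (t : R) : is_derive t 1 p (y - x) by exact: is_derive_line.
have pb t : 0 <= t <= 1 -> `|p t - x0| < r.
  move=> /andP[t0 t1].
  have -> : p t - x0 = (1 - t) *: (x - x0) + t *: (y - x0).
    apply/rowP => i; rewrite !mxE; ring.
  apply: le_lt_trans (ler_normD _ _) _; rewrite !normrZ (ger0_norm t0) ger0_norm; last lra.
  have [->|tn0] := eqVneq t 0; first lra.
  have : t * `|y - x0| < t * r by rewrite ltr_pM2l// lt_neqAle eq_sym tn0.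
  have : (1 - t) * `|x - x0| <= (1 - t) * r by apply: ler_wpM2l; lra.
  lra.
have pP t : 0 <= t <= 1 -> differentiable f (p t) /\
    forall v, `|'d f (p t) v - 'd f x0 v| <= e * `|v|.
  by move=> /pb pt; apply: rP; rewrite -ball_normE /= distrC.
pose w : 'rV[R]_n := 'd f x0 (y - x).
pose q : R -> 'rV[R]_n := fun t => f (p t) - (0 + t *: w).
have dq (t : R) : 0 <= t <= 1 -> is_derive t 1 q ('d f (p t) (y - x) - 'd f x0 (y - x)).
  move=> /pP[dfp _]; apply: is_deriveB; last exact: is_derive_line.
  exact: is_derive_diff_comp.
have -> : f y - f x - 'd f x0 (y - x) = q 1 - q 0.
  by rewrite /q /p !scale1r !scale0r !addr0 add0r subr0 [x + _]addrC subrK addrAC.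
have -> : e * `|y - x| = e * `|y - x| * (1 - 0) by rewrite subr0 mulr1.
apply: (path_lipschitz (dx := fun t => 'd f (p t) (y - x) - 'd f x0 (y - x))) => //.
- by move=> t /andP[t0 t1]; apply: dq; rewrite !ltW.
- apply: continuous_in_subspaceT => t; rewrite inE /= in_itv /= => t01.
  apply: differentiable_continuous; apply/derivable1_diffP.
  by have [] := dq _ t01.
- by move=> t /andP[t0 t1]; apply: (pP _ _).2; rewrite !ltW.
Qed.

End StrictDifferentiability.
End Calculus.

(** * Bounds on the vector field and the semiflow on K *)

Section CompactBounds.
Context {R : realType} {n : nat}.
Variables (K : set 'rV[R]_n) (f : 'rV[R]_n -> 'rV[R]_n).
Hypotheses (fs : smooth K f) (Kc : compact K).

Lemma bounded_on_compact : exists2 M : R, 0 < M & forall x, K x -> `|f x| <= M.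
Proof.
have : compact (f @` K).
  apply: continuous_compact => //; apply: continuous_in_subspaceT => x.
  rewrite inE => Kx; apply: differentiable_continuous.
  exact: nbhs_singleton (smooth_differentiable fs Kx).
move=> /compact_bounded/ex_strict_bound_gt0[M M0 MP]; exists M => // x Kx.
by apply: ltW; apply: MP; exists x.
Qed.

(** The segment between two points of [K] may leave the set where [f] is smooth,
    so the mean value inequality is applied to close points only; for points at
    distance at least [l0^-1] the bound on [f] gives the estimate. *)
Lemma lipschitz_on_compact :
  exists2 L : R, 0 < L & forall x y, K x -> K y -> `|f y - f x| <= L * `|y - x|.
Proof.
have [M M0 MP] := bounded_on_compact.
have : \forall l \near +oo, K `<=` [set x | forall y : 'rV[R]_n,
    `|y - x| < l^-1 -> `|f y - f x| <= l * `|y - x|].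
  (* a single large parameter l serves as the Lipschitz constant and, through
     its inverse, as the radius of validity *)
  move/compact_near_coveringP : Kc; apply => x0 Kx0.
  have dc : continuous ('d f x0).
    exact: diff_continuous (nbhs_singleton (smooth_differentiable fs Kx0)).
  have [k k0 kP] := linear_lipschitz dc.
  have [r r0 rP] := strict_differentiability fs Kx0 ltr01.
  have r20 : 0 < r / 2 by rewrite divr_gt0.
  exists (ball x0 (r / 2), [set l | Num.max (k + 1) (r / 2)^-1 < l]).
    split => /=; first exact: nbhsx_ballx.
    exact: nbhs_pinfty_gt (num_real _).
  move=> [x l] /= []; rewrite -ball_normE /= => xx0; rewrite gt_max => /andP[kl rl] y yx.
  have l0 : 0 < l by lra.
  have {}rl : l^-1 < r / 2 by rewrite invf_plt ?posrE.
  have := rP x y; have -> : `|x - x0| < r by rewrite distrC; lra.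
  have -> : `|y - x0| < r.
    have -> : y - x0 = (y - x) + (x - x0) by rewrite addrA subrK.
    by apply: le_lt_trans (ler_normD _ _) _; rewrite distrC in xx0; lra.
  move=> /(_ isT isT) h.
  have -> : f y - f x = (f y - f x - 'd f x0 (y - x)) + 'd f x0 (y - x) by rewrite subrK.
  apply: le_trans (ler_normD _ _) _.
  have := kP (y - x); have : (k + 1) * `|y - x| <= l * `|y - x|.
    by apply: ler_wpM2r => //; exact: ltW.
  lra.
move=> [l [_ lP]].
pose l0 := Num.max 1 (l + 1).
have ll0 : l < l0 by rewrite /l0 lt_max; apply/orP; right; lra.
have l00 : 0 < l0 by rewrite /l0 lt_max ltr01.
have {}lP := lP l0 ll0.
pose L := Num.max l0 (2 * M * l0).
exists L; first by rewrite lt_max l00.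
move=> x y Kx Ky; have [yx|yx] := ltP (`|y - x|) l0^-1.
  apply: le_trans (lP x Kx y yx) _; apply: ler_wpM2r => //.
  by rewrite le_max lexx.
have : `|f y - f x| <= 2 * M.
  apply: le_trans (ler_normB _ _) _; have := MP x Kx; have := MP y Ky; lra.
move=> /le_trans; apply.
apply: (@le_trans _ _ (2 * M * l0 * `|y - x|)).
  have h : 1 <= l0 * `|y - x| by rewrite -ler_pdivrMl // mulr1.
  by rewrite -mulrA ler_peMr // mulr_ge0 // ltW.
by apply: ler_wpM2r => //; rewrite le_max lexx orbT.
Qed.

End CompactBounds.

Section Flow.
Context {R : realType} {n : nat}.
Variables (K : set 'rV[R]_n) (f : 'rV[R]_n -> 'rV[R]_n).

(** What the rest of the development uses of the solutions that start in [K];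
    [phi a] is the solution issued from [a].  Outside of [K], and for negative
    times, its values are arbitrary. *)
Record semiflow (phi : 'rV[R]_n -> R -> 'rV[R]_n) : Prop := {
  flow0 : forall a, K a -> phi a 0 = a;
  flow_in : forall a (t : R), K a -> 0 <= t -> K (phi a t);
  flow_interior : forall a (t : R), K a -> 0 < t -> K° (phi a t);
  flow_derive : forall a (t : R), K a -> 0 < t -> is_derive t 1 (phi a) (f (phi a t));
  flow_continuous : forall a, K a -> {within `[0, +oo[, continuous (phi a)};
  flow_add : forall a (s t : R), K a -> 0 <= s -> 0 <= t ->
    phi (phi a s) t = phi a (s + t);
  flow_equilibrium : forall a (t : R), K a -> f a = 0 -> 0 <= t -> phi a t = a }.

Lemma solutionW (J I : set R) (x : R -> 'rV[R]_n) :
  I `<=` J -> solution f J x -> solution f I x.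
Proof.
move=> IJ [xc xd]; split; first exact: continuous_subspaceW xc.
by move=> t It; apply: xd; apply: interiorS It.
Qed.

Lemma ray_interior (t : R) : (`[0, +oo[ : set R)° t = (0 < t).
Proof. by rewrite interior_itv /= in_itv /= andbT. Qed.

Lemma solution_shift (x : R -> 'rV[R]_n) (s : R) : 0 <= s ->
  solution f `[0, +oo[ x -> solution f `[0, +oo[ (fun t => x (s + t)).
Proof.
move=> s0 [xc xd]; split.
  apply/subspace_continuousP => t /=; rewrite in_itv /= andbT => t0.
  have st : (`[0, +oo[%classic : set R) (s + t) by rewrite /= in_itv /= andbT addr_ge0.
  move/subspace_continuousP : (xc) => /(_ (s + t) st).
  move=> hx W /hx; rewrite !nbhs_simpl /within /= => hA.
  have : continuous (fun u : R => s + u) by move=> u; apply: cvgD; [exact: cvg_cst|exact: cvg_id].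
  move=> /(_ t _ hA); rewrite /= nbhs_simpl; apply: (@filterS _ (nbhs t)) => u hu /=; rewrite !in_itv /= !andbT => u0.
  by apply: hu; rewrite in_itv /= andbT addr_ge0.
move=> t; rewrite ray_interior => t0.
by apply: is_derive_shiftl; apply: xd; rewrite ray_interior ltr_wpDl.
Qed.

Lemma solution_cst (a : 'rV[R]_n) (J : set R) : f a = 0 -> solution f J (cst a).
Proof.
move=> fa; split; first by apply: continuous_subspaceT => ?; exact: cvg_cst.
by move=> t _; rewrite fa; exact: is_derive_cst.
Qed.

Hypothesis fsol : solutions_exist_unique f K.
Hypothesis Kinv : strictly_forward_invariant f K.

Lemma solution_interior (x : R -> 'rV[R]_n) t :
  solution f `[0, +oo[ x -> K (x 0) -> 0 < t -> K° (x t).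
Proof.
move=> xs Kx t0; apply: (Kinv (T := t + 1)) Kx _ _.
  by apply: solutionW xs => u /=; rewrite !in_itv /= andbT => /andP[].
by rewrite t0 ltrDl ltr01.
Qed.

Lemma solution_in (x : R -> 'rV[R]_n) t :
  solution f `[0, +oo[ x -> K (x 0) -> 0 <= t -> K (x t).
Proof.
move=> xs Kx; rewrite le_eqVlt => /predU1P[<-//|t0].
by apply: interior_subset; exact: solution_interior.
Qed.

Lemma solution_unique (x y : R -> 'rV[R]_n) t :
  solution f `[0, +oo[ x -> solution f `[0, +oo[ y -> K (x 0) -> x 0 = y 0 ->
  0 <= t -> x t = y t.
Proof.
move=> xs ys Kx xy t0; have [_ u] := fsol.
have J : `[0, t + 1[ `<=` (`[0, +oo[ : set R).
  by move=> s /=; rewrite !in_itv /= andbT => /andP[].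
apply: (u (t + 1)) Kx xy _ _; [exact: solutionW xs|exact: solutionW ys|].
by rewrite t0 ltrDl ltr01.
Qed.

Lemma semiflow_exists : exists2 phi, semiflow phi &
  forall x t, solution f `[0, +oo[ x -> K (x 0) -> 0 <= t -> x t = phi (x 0) t.
Proof.
have [ex _] := fsol.
have /choice[phi phiP] : forall a, exists x, K a -> solution f `[0, +oo[ x /\ x 0 = a.
  move=> a; have [Ka|nKa] := pselect (K a); last by exists (cst 0).
  by have [x xP] := ex a Ka; exists x.
exists phi; last first.
  move=> x t xs Kx t0; have [ps p0] := phiP _ Kx.
  by apply: solution_unique => //; rewrite p0.
have pin a t : K a -> 0 <= t -> K (phi a t).
  move=> Ka t0; have [ps p0] := phiP _ Ka.
  by apply: solution_in => //; rewrite p0.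
split => //.
- by move=> a /phiP[].
- move=> a t Ka t0; have [ps p0] := phiP _ Ka.
  by apply: solution_interior => //; rewrite p0.
- move=> a t /phiP[[_ pd] _] t0; apply: pd; by rewrite ray_interior.
- by move=> a /phiP[[]].
- move=> a s t Ka s0 t0; have [ps p0] := phiP _ Ka.
  have Ks := pin a s Ka s0; have [qs q0] := phiP _ Ks.
  apply: (solution_unique (y := fun t => phi a (s + t))) => //.
  + exact: solution_shift.
  + by rewrite q0.
  + by rewrite q0 addr0.
- move=> a t Ka fa t0; have [ps p0] := phiP _ Ka.
  rewrite (@solution_unique (phi a) (cst a) t) ?p0 //; exact: solution_cst.
Qed.

End Flow.

(** * Quantitative estimates for the semiflow *)

Section FlowEstimates.
Context {R : realType} {n : nat}.
Variables (K : set 'rV[R]_n) (f : 'rV[R]_n -> 'rV[R]_n).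
Variables (phi : 'rV[R]_n -> R -> 'rV[R]_n) (M L : R).
Hypothesis phiP : semiflow K f phi.
Hypotheses (M0 : 0 < M) (fM : forall x, K x -> `|f x| <= M).
Hypotheses (L0 : 0 < L)
  (fL : forall x y, K x -> K y -> `|f y - f x| <= L * `|y - x|).

Lemma flow_within a (s t : R) : K a -> 0 <= s ->
  {within `[s, t], continuous (phi a)}.
Proof.
move=> Ka s0; apply: continuous_subspaceW (flow_continuous phiP Ka).
by move=> u /=; rewrite !in_itv /= andbT => /andP[su _]; apply: le_trans su.
Qed.

Lemma flow_time_lipschitz a (s t : R) : K a -> 0 <= s -> 0 <= t ->
  `|phi a t - phi a s| <= M * `|t - s|.
Proof.
move=> Ka; wlog st : s t / s <= t => [h|] s0 t0.
  have [st|/ltW ts] := leP s t; first exact: h.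
  by rewrite distrC (distrC t); exact: h.
rewrite (ger0_norm (x := t - s)) ?subr_ge0 //.
have pos u : s < u < t -> 0 < u by move=> /andP[su _]; exact: le_lt_trans su.
apply: (path_lipschitz (dx := fun u => f (phi a u))) => //.
- by move=> u /pos u0; exact: (flow_derive phiP).
- exact: flow_within.
- by move=> u /pos u0; apply: fM; apply: (flow_in phiP) => //; exact: ltW.
Qed.

(** Gronwall's inequality for E = sum of the squares of the coordinates of the
    difference, because the sup norm is not differentiable: E' <= c E with
    c = 2 n L, so E exp (- c t) is nonincreasing. *)
Lemma flow_gronwall a b (t : R) : K a -> K b -> 0 <= t ->
  `|phi b t - phi a t| <= n.+1%:R * expR (2 * n%:R * L * t) * `|b - a|.
Proof.
move=> Ka Kb t0.
pose u (s : R) := phi b s - phi a s.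
pose c : R := 2 * n%:R * L.
have c0 : 0 <= c by rewrite !mulr_ge0 // ltW.
pose E (s : R) : R := \sum_(i < n) (u s 0 i) ^+ 2.
pose E' (s : R) : R := \sum_(i < n) 2 * u s 0 i * (f (phi b s) - f (phi a s)) 0 i.
have E0 (s : R) : 0 <= E s by apply: sumr_ge0 => i _; exact: sqr_ge0.
have uE (s : R) : `|u s| ^+ 2 <= E s.
  have : `|u s| <= Num.sqrt (E s).
    apply: row_norm_le => [|i]; first exact: sqrtr_ge0.
    rewrite -sqrtr_sqr ler_sqrt // /E (bigD1 i) //= lerDl.
    by apply: sumr_ge0 => j _; exact: sqr_ge0.
  by move=> h; rewrite -(sqr_sqrtr (E0 s)) ler_pXn2r // nnegrE ?sqrtr_ge0.
have dE (s : R) : 0 < s -> is_derive s 1 E (E' s).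
  move=> s0.
  have -> : E = \sum_(i < n) (fun r => u r 0 i) ^+ 2.
    by apply/funext => r; rewrite fct_sumE.
  apply: is_derive_eq.
    apply: is_derive_sum => i; apply: is_deriveX.
    by apply: is_derive_coord; apply: is_deriveB; exact: (flow_derive phiP).
  by apply: eq_bigr => i _; rewrite /GRing.scale /=; ring.
have E'E (s : R) : 0 < s -> E' s <= c * E s.
  move=> s0; have Kas := flow_in phiP Ka (ltW s0); have Kbs := flow_in phiP Kb (ltW s0).
  apply: (@le_trans _ _ (\sum_(i < n) 2 * L * `|u s| ^+ 2)).
    apply: ler_sum => i _; rewrite -2!mulrA ler_wpM2l //.
    apply: le_trans (ler_norm _) _; rewrite normrM.
    have -> : L * `|u s| ^+ 2 = `|u s| * (L * `|u s|) by ring.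
    apply: ler_pM => //; first exact: coord_norm_le.
    exact: le_trans (coord_norm_le _ _) (fL Kas Kbs).
  rewrite sumr_const card_ord -[_ *+ n]mulr_natr /c.
  have -> : 2 * L * `|u s| ^+ 2 * n%:R = 2 * n%:R * L * `|u s| ^+ 2 by ring.
  exact: ler_wpM2l.
pose G (s : R) : R := E s * expR (- c * s).
have G_le : G t <= G 0.
  have dG (s : R) : s \in `]0, t[%R -> is_derive s 1 G ((E' s - c * E s) * expR (- c * s)).
    rewrite in_itv /= => /andP[s0 _].
    have de : is_derive s 1 (fun r : R => expR (- c * r)) (expR (- c * s) * - c).
      apply: is_derive1_comp.
      have := is_derive_line 0 (- c) s; congr is_derive.
      by apply/funext => r; rewrite add0r mulrC.
    apply: (is_derive_eq (is_deriveM (dE s s0) de)).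
    by rewrite /GRing.scale /=; ring.
  have cG : {within `[0, t], continuous G}.
    move=> s; apply: continuousM.
      apply: (@continuous_big _ _ _ _ _ _ (subspace `[0, t]) _ (fun i r => u r 0 i ^+ 2)).
        exact: add_continuous.
      move=> i _ r.
      have cu : {for (r : subspace `[0, t]), continuous (fun r : subspace `[0, t] => u r 0 i)}.
        apply: continuous_coord; apply: continuousB; exact: flow_within.
      apply: continuousM; exact: cu.
    apply: continuous_subspaceT => r; apply: continuous_comp; last exact: continuous_expR.
    by apply: continuousM; [exact: cvg_cst|exact: cvg_id].
  move: (t0); rewrite le_eqVlt => /predU1P[<-//|tpos].
  have [s + GE] := MVT tpos dG cG.
  rewrite in_itv /= => /andP[s0 _].
  rewrite -subr_le0 GE.
  rewrite subr0; apply: mulr_le0_ge0 => //; apply: mulr_le0_ge0; last exact: expR_ge0.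
  by rewrite subr_le0; exact: E'E.
have Et : E t <= E 0 * expR (c * t).
  move: G_le; rewrite /G mulr0 expR0 mulr1 mulNr expRN ler_pdivrMr //.
  exact: expR_gt0.
have E0le : E 0 <= n.+1%:R * `|b - a| ^+ 2.
  apply: (@le_trans _ _ (\sum_(i < n) `|b - a| ^+ 2)).
    apply: ler_sum => i _; rewrite /u (flow0 phiP Ka) (flow0 phiP Kb).
    rewrite -real_normK ?num_real // ler_pXn2r ?nnegrE //; exact: coord_norm_le.
  rewrite sumr_const card_ord -[_ *+ n]mulr_natl; apply: ler_wpM2r => //.
  by rewrite ler_nat.
set C := n.+1%:R * expR (c * t).
have C1 : 1 <= C.
  rewrite -[1]mulr1; apply: ler_pM => //; first by rewrite ler1n.
  by rewrite -expR0 ler_expR mulr_ge0.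
have C0 : 0 <= C by apply: le_trans C1.
rewrite -(@ler_pXn2r _ 2) ?nnegrE // ?mulr_ge0 //.
apply: le_trans (uE t) _; apply: le_trans Et _.
apply: (@le_trans _ _ (C * `|b - a| ^+ 2)).
  rewrite /C -mulrA [expR _ * _]mulrC mulrA; apply: ler_wpM2r => //; exact: expR_ge0.
by rewrite exprMn; apply: ler_wpM2r => //; rewrite expr2 ler_peMr.
Qed.

Lemma flow_lipschitz (T : R) : 0 <= T -> exists2 E : R, 1 <= E &
  forall a b t, K a -> K b -> 0 <= t <= T -> `|phi b t - phi a t| <= E * `|b - a|.
Proof.
move=> T0; have c0 : 0 <= 2 * n%:R * L by rewrite !mulr_ge0 // ltW.
exists (n.+1%:R * expR (2 * n%:R * L * T)).
  rewrite -[leLHS]mulr1; apply: ler_pM => //; first by rewrite ler1n.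
  by rewrite -[leLHS]expR0 ler_expR; exact: mulr_ge0.
move=> a b t Ka Kb /andP[t0 tT]; apply: le_trans (flow_gronwall Ka Kb t0) _.
apply: ler_wpM2r => //; apply: ler_wpM2l => //.
by rewrite ler_expR; exact: ler_wpM2l.
Qed.

(** Some coordinate of the velocity at time t has size at least m / 2.  Over a
    time [th] the point moves by at most M |th|, so this coordinate keeps size at
    least m / 4, and the mean value theorem turns it into a displacement.  This
    is why a wrong clock is visible away from equilibria. *)
Lemma flow_escape a (t th m : R) : K a -> 0 <= t -> 0 <= t + th ->
  0 < m -> m / 2 <= `|f (phi a t)| -> L * (M * `|th|) <= m / 4 ->
  m / 4 * `|th| <= `|phi a (t + th) - phi a t|.
Proof.
move=> Ka t0 tth0 m0 fm thm.
have [->|th0] := eqVneq th 0; first by rewrite normr0 mulr0.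
have [i fi] : exists i, m / 2 <= `|f (phi a t) 0 i|.
  have fn0 : `|f (phi a t)| != 0 by rewrite gt_eqF // (lt_le_trans _ fm) // divr_gt0.
  have [[j i] /= e] := mx_norm_neq0 fn0; exists i; apply: le_trans fm _.
  by rewrite [j]ord1 in e; rewrite -e.
have near_f (s : R) : 0 <= s -> `|s - t| <= `|th| -> m / 4 <= `|f (phi a s) 0 i|.
  move=> s0 sth.
  have h1 : `|(f (phi a s) - f (phi a t)) 0 i| <= m / 4.
    apply: le_trans (coord_norm_le _ _) _.
    apply: le_trans (fL (flow_in phiP Ka t0) (flow_in phiP Ka s0)) _.
    apply: le_trans thm; apply: ler_wpM2l; first exact: ltW.
    apply: le_trans (flow_time_lipschitz Ka t0 s0) _.
    by apply: ler_wpM2l => //; exact: ltW.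
  have := lerB_dist (f (phi a t) 0 i) (f (phi a t) 0 i - f (phi a s) 0 i).
  rewrite opprB addrCA subrr addr0.
  have : `|f (phi a t) 0 i - f (phi a s) 0 i| <= m / 4 by rewrite distrC; move: h1; rewrite !mxE.
  lra.
apply: le_trans (coord_norm_le _ i).
have mvt (s1 s2 : R) : 0 <= s1 -> s1 < s2 ->
    exists2 c, s1 < c < s2 & (phi a s2 - phi a s1) 0 i = f (phi a c) 0 i * (s2 - s1).
  move=> s10 s12; apply: (coord_MVT (dx := fun s => f (phi a s)) i s12).
    move=> s /andP[s1s _]; apply: (flow_derive phiP) => //; exact: le_lt_trans s1s.
  exact: flow_within.
have [thpos|thneg] := ltP 0 th.
  have [|c /andP[c1 c2] ->] := mvt t (t + th) t0; first by rewrite ltrDl.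
  rewrite addrAC subrr add0r normrM; apply: ler_wpM2r => //; apply: near_f.
    exact: le_trans (ltW c1).
  by rewrite !gtr0_norm ?subr_gt0 //; lra.
have {}thneg : th < 0 by rewrite lt_neqAle th0.
have [|c /andP[c1 c2] e] := mvt (t + th) t tth0; first by rewrite gtrDl.
have -> : (phi a (t + th) - phi a t) 0 i = - (phi a t - phi a (t + th)) 0 i.
  by rewrite -opprB mxE.
rewrite normrN e opprD addrA subrr add0r normrM normrN.
apply: ler_wpM2r => //; apply: near_f; first exact: le_trans (ltW c1).
by rewrite !ltr0_norm ?subr_lt0 //; lra.
Qed.

End FlowEstimates.

(** * The Finsler function and the norm *)

Section Finsler.
Context {R : realType} {n : nat}.
Variables (K : set 'rV[R]_n) (f : 'rV[R]_n -> 'rV[R]_n).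
Variables (V : 'rV[R]_n -> 'rV[R]_n -> R).
Hypotheses (Kc : compact K) (VF : finsler_metric K V).

Let W (p : 'rV[R]_n * 'rV[R]_n) : R := V p.1 p.2.
Let A : set ('rV[R]_n * 'rV[R]_n) := K `*` [set d | d != 0].

Lemma finsler_diff x d : K x -> d != 0 -> differentiable W (x, d).
Proof.
move=> Kx d0; have Axd : A (x, d) by [].
exact: nbhs_singleton (smooth_differentiable (finsler_smooth VF) Axd).
Qed.

(** The contraction hypothesis is stated with partial differentials; the
    estimates use the differential of [V] as a function of the pair (point,
    displacement), which is jointly continuous. *)
Lemma finsler_diff_fst x d a : K x -> d != 0 -> 'd (V^~ d) x a = 'd W (x, d) (a, 0).
Proof.
move=> Kx d0; have dW := finsler_diff Kx d0.
have dV : differentiable (V^~ d) x.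
  have -> : V^~ d = W \o (fun y : 'rV[R]_n => (y, d)) by [].
  by apply: differentiable_comp => //; apply: differentiable_pair.
rewrite -(deriveE _ dV) -(deriveE _ dW) /derive.
suff -> : (fun h : R => h^-1 *: ((V^~ d \o shift x) (h *: a) - V x d)) =
    (fun h => h^-1 *: ((W \o shift (x, d)) (h *: (a, 0)) - W (x, d))) by [].
by apply/funext => h /=; rewrite /W /= scaler0 add0r.
Qed.

Lemma finsler_diff_snd x d b : K x -> d != 0 -> 'd (V x) d b = 'd W (x, d) (0, b).
Proof.
move=> Kx d0; have dW := finsler_diff Kx d0.
have dV : differentiable (V x) d.
  have -> : V x = W \o (fun y : 'rV[R]_n => (x, y)) by [].
  by apply: differentiable_comp => //; apply: differentiable_pair.
rewrite -(deriveE _ dV) -(deriveE _ dW) /derive.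
suff -> : (fun h : R => h^-1 *: ((V x \o shift d) (h *: b) - V x d)) =
    (fun h => h^-1 *: ((W \o shift (x, d)) (h *: (0, b)) - W (x, d))) by [].
by apply/funext => h /=; rewrite /W /= scaler0 add0r.
Qed.

Lemma finsler_zero x : K x -> V x 0 = 0.
Proof.
move=> Kx; have := finsler_homogeneous VF 0 Kx (ltr0n _ 2); rewrite scaler0; lra.
Qed.

Lemma compact_unit_sphere : compact [set u : 'rV[R]_n | `|u| = 1].
Proof.
apply: bounded_closed_compact.
  by exists 1; split => // r r1 u /= ->; exact: ltW.
apply: (@closed_comp _ _ (fun u : 'rV[R]_n => `|u|) [set 1]).
  by move=> u _; exact: norm_continuous.
exact: closed_eq.
Qed.

Lemma finsler_scale x d : K x -> d != 0 ->
  V x d = `|d| * V x (`|d|^-1 *: d).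
Proof.
move=> Kx d0; rewrite -(finsler_homogeneous VF _ Kx) ?normr_gt0 //.
by rewrite scalerA divff ?scale1r // normr_eq0.
Qed.

(** [V] is bounded and bounded away from 0 on the compact set of unit
    displacements over [K]; homogeneity extends the bounds. *)
Lemma finsler_norm_equiv : exists2 c : R, 0 < c &
  forall x d, K x -> `|d| <= c * V x d /\ V x d <= c * `|d|.
Proof.
have : \forall l \near +oo, (K `*` [set u : 'rV[R]_n | `|u| = 1]) `<=`
    [set p | 1 <= l * W p /\ W p <= l].
  have /compact_near_coveringP := compact_setX Kc compact_unit_sphere; apply.
  move=> p0 [Kx0 /= u0]; have u00 : p0.2 != 0 by rewrite -normr_gt0 u0.
  have W0 : 0 < W p0 by apply: (finsler_pos VF).
  have := finsler_diff Kx0 u00; rewrite -surjective_pairing.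
  move=> /differentiable_continuous cW.
  have W02 : 0 < W p0 / 2 by rewrite divr_gt0.
  have /cvgrPdist_lt/(_ _ W02) hW := cW.
  exists ([set p | `|W p0 - W p| < W p0 / 2],
    [set l | Num.max (2 * W p0) (W p0 / 2)^-1 < l]).
    by split => //=; exact: nbhs_pinfty_gt (num_real _).
  move=> [p l] /= []; rewrite ltr_norml gt_max => /andP[h1 h2] /andP[h3 h4].
  have l0 : 0 < l by lra.
  split; last by lra.
  have : 1 <= l * (W p0 / 2).
    by rewrite -ler_pdivrMr // mul1r ltW.
  move=> /le_trans; apply; apply: ler_wpM2l; [exact: ltW|lra].
move=> [l [_ lP]]; pose c := Num.max 1 (l + 1).
have c0 : 0 < c by rewrite /c lt_max ltr01.
have {}lP := lP c; have lc : l < c by rewrite /c lt_max; apply/orP; right; lra.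
exists c => // x d Kx; have [->|d0] := eqVneq d 0.
  by rewrite finsler_zero // normr0 mulr0.
rewrite (finsler_scale Kx d0).
have d00 : 0 < `|d| by rewrite normr_gt0.
have [] := lP lc (x, `|d|^-1 *: d).
  by split => //=; rewrite normrZ normfV normr_id mulVf // gt_eqF.
rewrite /W /= => h1 h2; split.
  by rewrite mulrCA -{1}[`|d|]mulr1; apply: ler_wpM2l.
by rewrite mulrC; apply: ler_wpM2r.
Qed.

(** Homogeneity of [V] in the displacement holds over [K] only, so it can be
    differentiated with respect to the point only in the interior of [K]. *)
Lemma finsler_diff_scale x u (a b : 'rV[R]_n) (r : R) : K° x -> u != 0 -> 0 < r ->
  'd W (x, r *: u) (a, r *: b) = r * 'd W (x, u) (a, b).
Proof.
move=> Kx u0 r0; have Kx' := interior_subset Kx.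
have ru0 : r *: u != 0 by rewrite scaler_eq0 negb_or u0 gt_eqF.
have l1 := is_derive_line (x, r *: u) (a, r *: b) (0 : R).
have l2 := is_derive_line (x, u) (a, b) (0 : R).
pose p1 (s : R) : 'rV[R]_n * 'rV[R]_n := (x, r *: u) + s *: (a, r *: b).
pose p2 (s : R) : 'rV[R]_n * 'rV[R]_n := (x, u) + s *: (a, b).
have p10 : p1 0 = (x, r *: u) by rewrite /p1 scale0r addr0.
have p20 : p2 0 = (x, u) by rewrite /p2 scale0r addr0.
have W1 : differentiable W (p1 0) by rewrite p10; exact: finsler_diff.
have W2 : differentiable W (p2 0) by rewrite p20; exact: finsler_diff.
have d1 := @is_derive_diff_comp _ _ _ W p1 _ _ l1 W1.
have d2 := @is_derive_diff_comp _ _ _ W p2 _ _ l2 W2.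
rewrite p10 in d1; rewrite p20 in d2.
have E : \forall s \near (0 : R), (r *: (W \o p2)) s = (W \o p1) s.
  have cx : {for (0 : R), continuous (fun s : R => x + s *: a)}.
    apply: differentiable_continuous; apply/derivable1_diffP.
    by have [] := is_derive_line x a (0 : R).
  have : nbhs (x + (0 : R) *: a) K by rewrite scale0r addr0.
  move=> /cx; rewrite /= nbhs_simpl; apply: (@filterS _ (nbhs (0 : R))) => s /= Ks.
  rewrite /W /p1 /p2 /=.
  have -> : r *: u + s *: (r *: b) = r *: (u + s *: b).
    by rewrite scalerDr !scalerA mulrC.
  by rewrite (finsler_homogeneous VF) .
have d3 := near_eq_is_derive E (is_deriveZ r d2).
have [_ e1] := d1; have [_ e3] := d3.
exact: etrans (esym e1) e3.
Qed.

End Finsler.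

(** * Contraction of small finite displacements *)

Section LocalContractionErrors.
Context {R : realType}.

Lemma norm_sub_le (a b c : R) : `|a - b| <= c -> a <= b + c.
Proof. by rewrite ler_norml => /andP[_]; rewrite lerBlDl. Qed.

(** The next two lemmas are the error budgets of [local_contraction_unit]: the
    factor of [eta] on the right of the first collects all the constants that
    multiply the size [eta] of the neighbourhood. *)
Lemma transverse_error (M L k kA lambda eta : R) :
  0 < L -> 0 < k -> 0 < kA -> 0 < lambda -> 0 < eta ->
  k * (L * (2 * eta)) + eta * M <=
    eta * (M + L + k * (2 * L + 1 + kA) + lambda / 2 + 1).
Proof.
move=> L0 k0 kA0 l0 eta0.
have h1 : 0 < k * (1 + kA) by rewrite mulr_gt0 // addr_gt0.
have h2 : 0 < lambda / 2 by rewrite divr_gt0.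
have h3 : 0 <= eta * (L + k * (1 + kA) + lambda / 2 + 1).
  by rewrite mulr_ge0 // ?(ltW eta0) // !addr_ge0 // ltW.
lra.
Qed.

Lemma contraction_error (M L k kA lambda eta w1 w2 w3 v v0 : R) :
  0 <= eta -> 0 <= k -> 0 <= L -> 0 < lambda ->
  w3 <= - lambda * v0 -> w1 <= w2 + eta * (M + L) ->
  w2 <= w3 + k * (L * eta + (eta + kA * eta)) ->
  - eta < v0 - v ->
  eta * (M + L + k * (2 * L + 1 + kA) + lambda / 2 + 1) < lambda / 2 * v0 ->
  w1 < - (lambda / 2) * v.
Proof.
move=> eta0 k0 L0 l0 h1 h2 h3 h4 h5.
have h6 : lambda / 2 * v <= lambda / 2 * (v0 + eta).
  by apply: ler_wpM2l; [rewrite divr_ge0 // ltW|lra].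
have h7 : 0 <= eta * (k * L) by rewrite !mulr_ge0.
lra.
Qed.

End LocalContractionErrors.

Section LocalContraction.
Context {R : realType} {n : nat}.
Variables (K : set 'rV[R]_n) (f : 'rV[R]_n -> 'rV[R]_n).
Variables (V : 'rV[R]_n -> 'rV[R]_n -> R) (lambda : R).
Hypotheses (fs : smooth K f) (Kc : compact K) (VF : finsler_metric K V).
Hypotheses (l0 : 0 < lambda) (VC : transverse_contraction f K V lambda).

Let W (p : 'rV[R]_n * 'rV[R]_n) : R := V p.1 p.2.
Let S : set 'rV[R]_n := [set u | `|u| = 1].

Lemma le_of_eq (a b : R) : a = b -> a <= b.
Proof. by move=> ->. Qed.

Lemma transverse_diff x u : K x -> u != 0 -> 'd W (x, u) (0, f x) = 0 ->
  'd W (x, u) (f x, 'd f x u) <= - lambda * V x u.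
Proof.
move=> Kx u0 tr.
have h := VC Kx u0 (etrans (finsler_diff_snd VF (f x) Kx u0) tr).
apply: le_trans h; rewrite le_eqVlt; apply/orP; left; apply/eqP.
transitivity ('d W (x, u) (f x, 0) + 'd W (x, u) (0, 'd f x u)).
  rewrite -linearD; congr ('d W _ _).
  by congr pair; rewrite /= ?addr0 ?add0r.
congr (_ + _); apply/esym; first exact: (finsler_diff_fst VF).
rewrite /jacobian mul_rV_lin1; exact: (finsler_diff_snd VF).
Qed.

(** The contraction inequality for a displacement r u, divided by r, in the limit
    r -> 0.  If 'd W (x0, u0) (0, f x0) is not 0, then neither of the two
    transversality conditions can hold nearby.  If it is 0, the hypothesis
    applies at (x0, u0) and, since (f (x + r u) - f x) / r is close to
    'd f x0 u0, it survives nearby with [lambda] replaced by [lambda / 2]. *)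
Lemma local_contraction_unit (x0 u0 : 'rV[R]_n) : K x0 -> `|u0| = 1 ->
  \forall p \near (x0, u0) & r \near (0 : R)^'+, (K `*` S) p -> forall y, K y ->
    y = p.1 + r *: p.2 ->
    'd W p (0, f y) = 0 \/ 'd W p (0, f p.1) = 0 ->
    'd W p (f p.1, r^-1 *: (f y - f p.1)) < - (lambda / 2) * W p.
Proof.
move=> Kx0 u01.
have u00 : u0 != 0 by rewrite -normr_gt0 u01.
have [M M0 fM] := bounded_on_compact fs Kc.
have [L L0 fL] := lipschitz_on_compact fs Kc.
have Ap0 : (K `*` [set d | d != 0]) (x0, u0) by [].
have dW0 : differentiable W (x0, u0).
  exact: nbhs_singleton (smooth_differentiable (finsler_smooth VF) Ap0).
have dc : continuous ('d W (x0, u0)) by exact: diff_continuous dW0.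
have [k k0 kP'] : exists2 k : R, 0 < k & forall v, `|'d W (x0, u0) v| <= k * `|v|.
  exact: linear_lipschitz dc.
have kP v w : `|'d W (x0, u0) (v, w)| <= k * (`|v| + `|w|).
  apply: le_trans (kP' _) _; apply: ler_wpM2l; first exact: ltW.
  by rewrite prod_normE /= ge_max lerDl lerDr !normr_ge0.
have dfc : continuous ('d f x0).
  exact: diff_continuous (nbhs_singleton (smooth_differentiable fs Kx0)).
have [kA kA0 kAP] : exists2 k : R, 0 < k & forall v, `|'d f x0 v| <= k * `|v|.
  exact: linear_lipschitz dfc.
have W0 : 0 < W (x0, u0) by apply: (finsler_pos VF).
pose al := 'd W (x0, u0) (0, f x0).
(* be is the margin available in each of the two cases; eta is chosen so that
   the total error eta * C stays below it *)
pose be := if al == 0 then lambda / 2 * W (x0, u0) else `|al|.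
have be0 : 0 < be.
  by rewrite /be; case: eqP => [_|/eqP ?]; [rewrite mulr_gt0 // divr_gt0|rewrite normr_gt0].
pose C := M + L + k * (2 * L + 1 + kA) + lambda / 2 + 1.
have C0 : 0 < C.
  by rewrite /C !addr_gt0 // ?divr_gt0 // mulr_gt0 // !addr_gt0 // mulr_gt0.
pose eta := be / (2 * C).
have eta0 : 0 < eta by rewrite divr_gt0 // mulr_gt0.
have etaC : eta * C < be.
  have -> : eta * C = be / 2 by rewrite /eta; field; rewrite gt_eqF.
  lra.
have [r1 r10 r1P] := strict_differentiability fs Kx0 eta0.
pose rr := Num.min eta (r1 / 2).
have rr0 : 0 < rr by rewrite lt_min eta0 divr_gt0.
have h1 := near_diff_smooth_prod (finsler_smooth VF) Ap0 eta0.
have h2 : \forall p \near (x0, u0), `|W (x0, u0) - W p| < eta.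
  by have /cvgrPdist_lt/(_ _ eta0) := differentiable_continuous dW0.
have h3 : \forall p \near (x0, u0), `|p.1 - x0| < rr /\ `|p.2 - u0| < eta.
  have a1 : \forall p \near (x0, u0), `|x0 - p.1| < rr.
    have c1 : {for (x0, u0), continuous (fst : 'rV[R]_n * 'rV[R]_n -> 'rV[R]_n)} by exact: cvg_fst.
    by have /cvgrPdist_lt/(_ _ rr0) := c1.
  have a2 : \forall p \near (x0, u0), `|u0 - p.2| < eta.
    have c2 : {for (x0, u0), continuous (snd : 'rV[R]_n * 'rV[R]_n -> 'rV[R]_n)} by exact: cvg_snd.
    by have /cvgrPdist_lt/(_ _ eta0) := c2.
  by apply: filterS2 a1 a2 => p b1 b2; split; rewrite distrC.
exists ([set p | (differentiable W p /\ forall v w, `|'d W p (v, w) - 'd W (x0, u0) (v, w)| <=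
    eta * (`|v| + `|w|)) /\ `|W (x0, u0) - W p| < eta /\ (`|p.1 - x0| < rr /\ `|p.2 - u0| < eta)],
    [set r | 0 < r /\ r < rr]).
  split; first by apply: filterI => //; exact: filterI.
  by apply: filterI; [exact: nbhs_right_gt|exact: nbhs_right_lt].
case=> [[x u] r] /= [[[dW wP] [VP [xP uP]]] [r0 rrr]] [Kx u1] y Ky ye tr.
have {}u1 : `|u| = 1 := u1.
have yx : y - x = r *: u by rewrite ye addrC addKr.
have yxn : `|y - x| = r by rewrite yx normrZ u1 mulr1 gtr0_norm.
have rreta : rr <= eta by rewrite ge_min lexx.
have rrr1 : rr <= r1 / 2 by rewrite ge_min lexx orbT.
have yx0 : `|y - x0| < 2 * rr.
  have -> : y - x0 = (y - x) + (x - x0) by rewrite addrA subrK.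
  have -> : 2 * rr = rr + rr by ring.
  by apply: le_lt_trans (ler_normD _ _) _; rewrite yxn; exact: ltrD.
have wz z : K z -> `|z - x0| < 2 * eta -> 'd W (x, u) (0, f z) = 0 -> al = 0.
  move=> Kz zx wz0; apply/eqP; rewrite -[_ == _]negbK; apply/negP => al0.
  have : `|al| <= eta * C.
    have e1 : 'd W (x0, u0) (0, f x0 - f z) = al - 'd W (x0, u0) (0, f z).
      transitivity ('d W (x0, u0) ((0, f x0) - (0, f z))); last exact: linearB.
      by congr ('d W _ _); congr pair; rewrite /= ?subr0.
    have e2 : `|'d W (x0, u0) (0, f z)| <= eta * (`|(0 : 'rV[R]_n)| + `|f z|).
      have E : 'd W (x, u) (0, f z) - 'd W (x0, u0) (0, f z) = - 'd W (x0, u0) (0, f z).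
        exact: etrans (congr1 (fun t => t - 'd W (x0, u0) (0, f z)) wz0) (sub0r _).
      apply: le_trans (wP 0 (f z)); apply: le_of_eq.
      exact: etrans (esym (normrN _)) (esym (congr1 (fun t => `|t|) E)).
    have e3 := kP 0 (f x0 - f z).
    move: e1 e2 e3; rewrite normr0 !add0r.
    move: ('d W (x0, u0) (0, f x0 - f z)) ('d W (x0, u0) (0, f z)) => w1 w2 e1 e2 e3.
    have {e1} -> : al = w1 + w2 by rewrite e1 subrK.
    apply: le_trans (ler_normD _ _) _; move: e2 e3.
    have := fL _ _ Kz Kx0; have := fM _ Kz => b1 b2 b3 b4.
    have : k * `|f x0 - f z| <= k * (L * (2 * eta)).
      apply: ler_wpM2l; first exact: ltW.
      apply: le_trans b2 _; apply: ler_wpM2l; first exact: ltW.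
      by rewrite distrC; exact: ltW.
    have : eta * `|f z| <= eta * M by apply: ler_wpM2l => //; exact: ltW.
    move=> g1 g2; apply: le_trans (transverse_error M L0 k0 kA0 l0 eta0).
    by apply: lerD; [exact: le_trans b4 g2|exact: le_trans b3 g1].
  by move: etaC; rewrite /be (negbTE al0) => /lt_le_trans h /h; rewrite ltxx.
have al0 : al = 0.
  have rr2 : 2 * rr <= 2 * eta by rewrite ler_pM2l.
  case: tr => [tr|tr]; [apply: (wz y)|apply: (wz x)] => //.
    exact: lt_le_trans rr2.
  by apply: lt_le_trans xP _; apply: le_trans rreta _; rewrite ler_peMl ?ler1n // ltW.
have {}etaC : eta * C < lambda / 2 * W (x0, u0) by move: etaC; rewrite /be al0 eqxx.
pose Q := r^-1 *: (f y - f x).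
have Qn : `|Q| <= L.
  rewrite /Q normrZ gtr0_norm ?invr_gt0 // ler_pdivrMl // mulrC -yxn; exact: fL.
have QA : `|Q - 'd f x0 u0| <= eta + kA * eta.
  have -> : Q - 'd f x0 u0 = r^-1 *: (f y - f x - 'd f x0 (y - x)) + 'd f x0 (u - u0).
    have e1 : 'd f x0 (y - x) = r *: 'd f x0 u.
      exact: etrans (congr1 _ yx) (linearZZ _ _ _).
    have e2 : 'd f x0 (u - u0) = 'd f x0 u - 'd f x0 u0 by exact: linearB.
    rewrite [X in _ = X + _]scalerBr -/Q e1 e2 scalerA mulVf ?gt_eqF // scale1r.
    by rewrite addrA subrK.
  apply: le_trans (ler_normD _ _) _; apply: lerD.
    rewrite normrZ gtr0_norm ?invr_gt0 // ler_pdivrMl // mulrC.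
    rewrite -yxn; apply: r1P.
      apply: lt_le_trans xP _; apply: le_trans rrr1 _.
      by rewrite ler_pdivrMr // ler_peMr ?ler1n // ltW.
    by apply: lt_le_trans yx0 _; rewrite mulrC -ler_pdivlMr.
  apply: le_trans (kAP _) _; apply: ler_wpM2l; exact: ltW.
have tr0 := transverse_diff Kx0 u00.
have {}tr0 := tr0 al0.
have e1 : 'd W (x, u) (f x, Q) <= 'd W (x0, u0) (f x, Q) + eta * (M + L).
  apply: norm_sub_le; apply: le_trans (wP (f x) Q) _.
  by apply: ler_wpM2l; [exact: ltW|apply: lerD => //; exact: fM].
have e2 : 'd W (x0, u0) (f x, Q) <= 'd W (x0, u0) (f x0, 'd f x0 u0) +
    k * (L * eta + (eta + kA * eta)).
  apply: norm_sub_le.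
  have E1 : 'd W (x0, u0) (f x - f x0, Q - 'd f x0 u0) =
      'd W (x0, u0) (f x, Q) - 'd W (x0, u0) (f x0, 'd f x0 u0).
    exact: (linearB ('d W (x0, u0)) (f x, Q) (f x0, 'd f x0 u0)).
  apply: le_trans (le_of_eq (esym (congr1 (fun t => `|t|) E1))) _.
  apply: le_trans (kP _ _) _; apply: ler_wpM2l; first exact: ltW.
  apply: lerD => //; apply: le_trans (fL _ _ Kx0 Kx) _.
  apply: ler_wpM2l; first exact: ltW.
  exact: le_trans (ltW xP) rreta.
move: VP; rewrite ltr_norml => /andP[VP1 _].
apply: (contraction_error (ltW eta0) _ _ l0 tr0 e1 e2 VP1 etaC).
  exact: ltW.
exact: ltW.
Qed.


(** Compactness of the set of unit displacements over [K] makes the size of the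
    admissible displacements uniform, and homogeneity in the displacement scales
    them back.  The condition involving [f y] is the one met at a minimising time
    offset; the condition involving [f x] is trivially met at an equilibrium. *)
Lemma local_contraction : exists2 rho : R, 0 < rho & forall x y,
  K° x -> K y -> x != y -> `|y - x| < rho ->
  'd W (x, y - x) (0, f y) = 0 \/ 'd W (x, y - x) (0, f x) = 0 ->
  'd W (x, y - x) (f x, f y - f x) < - (lambda / 2) * V x (y - x).
Proof.
have : \forall r \near (0 : R)^'+, (K `*` S) `<=` [set p | forall y, K y ->
    y = p.1 + r *: p.2 ->
    'd W p (0, f y) = 0 \/ 'd W p (0, f p.1) = 0 ->
    'd W p (f p.1, r^-1 *: (f y - f p.1)) < - (lambda / 2) * W p].
  have /compact_near_coveringP/near_covering_withinP := compact_setX Kc (@compact_unit_sphere R n).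
  apply => -[x0 u0] [Kx0 Su0]; exact: local_contraction_unit.
rewrite near_withinE => /nbhs_ballP[rho /= rho0 rhoP].
exists rho => // x y Kx Ky xy yx tr; pose r := `|y - x|.
have Kx' := interior_subset Kx.
have r0 : 0 < r by rewrite normr_gt0 subr_eq0 eq_sym.
pose u := r^-1 *: (y - x).
have u1 : `|u| = 1 by rewrite /u normrZ gtr0_norm ?invr_gt0 // mulVf // gt_eqF.
have u0 : u != 0 by rewrite -normr_gt0 u1.
have ru : y - x = r *: u by rewrite /u scalerA divff ?scale1r // gt_eqF.
have scale a b : 'd W (x, y - x) (a, b) = r * 'd W (x, u) (a, r^-1 *: b).
  have := finsler_diff_scale VF a (r^-1 *: b) Kx u0 r0.
  by rewrite -ru scalerA divff ?scale1r // gt_eqF.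
have tr' z : 'd W (x, y - x) (0, f z) = 0 -> 'd W (x, u) (0, f z) = 0.
  move=> h.
  have pE : (0, r^-1 *: f z) = r^-1 *: ((0 : 'rV[R]_n), f z) :> 'rV[R]_n * 'rV[R]_n.
    by congr pair; rewrite scaler0.
  have Z : 'd W (x, u) (0, r^-1 *: f z) = r^-1 * 'd W (x, u) (0, f z).
    exact: etrans (congr1 _ pE) (linearZZ _ _ _).
  have := etrans (esym (congr1 (fun t => r * t) Z)) (etrans (esym (scale 0 (f z))) h).
  by move: ('d W (x, u) (0, f z)) => t; rewrite mulrA divff ?gt_eqF // mul1r.
have {}tr : 'd W (x, u) (0, f y) = 0 \/ 'd W (x, u) (0, f x) = 0.
  by case: tr => /tr'; [left|right].
have rb : ball (0 : R) rho r by rewrite -ball_normE /= sub0r normrN gtr0_norm.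
have /= := rhoP r rb r0 (x, u).
move=> /(_ (conj Kx' u1) y Ky); rewrite /= -ru addrC subrK => /(_ erefl tr) h.
rewrite scale ru (finsler_homogeneous VF) // mulrCA ltr_pM2l //.
Qed.

End LocalContraction.

(** * Decay of a minimum over a compact window *)

Section MinimalDecay.
Context {R : realType}.

Lemma compact_sublevel (T : topologicalType) (A : set T) (g : T -> R) :
  compact A -> {within A, continuous g} -> compact (A `&` [set p | g p <= 0]).
Proof.
move=> Ac gc.
have : closed ((g : subspace A -> R) @^-1` [set r : R | r <= 0]).
  by move/continuous_closedP : gc; apply; exact: closed_le.
move/closed_subspaceP => [U Uc UA]; rewrite setIC -UA setIC.
exact: compact_closedI.
Qed.

(** Let [t0] be the last time at which some offset satisfies the bound, and [th]
    a minimising offset at time [t0].  If [t0 < T], then keeping [th] fixed, the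
    function g _ th still satisfies the bound slightly later: by continuity if
    the bound at [t0] is strict, and otherwise because g _ th decreases faster
    than the bound.  So [t0 = T]. *)
Lemma minimal_decay (g : R -> R -> R) (a s T B mu th0 : R) :
  s <= T -> 0 < B ->
  {within `[s, T] `*` `[- a, a], continuous (fun p : R * R => g p.1 p.2)} ->
  - a <= th0 <= a -> g s th0 <= B ->
  (forall t th, s <= t < T -> - a <= th <= a ->
    (forall th', - a <= th' <= a -> g t th <= g t th') -> 0 < g t th ->
    exists2 d, is_derive t 1 (g^~ th) d & d < - mu * g t th) ->
  exists th, [/\ - a <= th <= a, forall th', - a <= th' <= a -> g T th <= g T th' &
    g T th <= B * expR (- mu * (T - s))].
Proof.
move=> sT B0 gc th0a gB crit.
pose b (t : R) := B * expR (- mu * (t - s)).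
have b0 t : 0 < b t by rewrite mulr_gt0 // expR_gt0.
have db (t : R) : is_derive t 1 b (- mu * b t).
  have := is_derive_line (mu * s) (- mu) t => l.
  have l' : is_derive t (1 : R) (fun u : R => - mu * (u - s)) (- mu).
    by move: l; congr is_derive; apply/funext => u; rewrite /GRing.scale /=; ring.
  have e : is_derive t (1 : R) (expR \o (fun u : R => - mu * (u - s)))
      (expR (- mu * (t - s)) * - mu).
    by apply: is_derive1_comp.
  by apply: (is_derive_eq (is_deriveZ B e)); rewrite /GRing.scale /= /b; ring.
have bc : continuous b.
  by move=> t; apply: differentiable_continuous; apply/derivable1_diffP; have [] := db t.
pose Q : set (R * R) := `[s, T] `*` `[- a, a].
have Qc : compact Q by apply: compact_setX; exact: segment_compact.
have bc' : {within Q, continuous (fun p : R * R => b p.1)}.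
  apply: continuous_subspaceT => q.
  apply: (@continuous_comp _ _ _ (fst : R * R -> R) b); [exact: cvg_fst|exact: bc].
have gbc : {within Q, continuous (fun p : R * R => g p.1 p.2 - b p.1)}.
  by move=> p; apply: (@cvgB _ R^o); [exact: gc|exact: bc'].
have Dc := compact_sublevel Qc gbc.
have D0 : Q `&` [set p | g p.1 p.2 - b p.1 <= 0] !=set0.
  exists (s, th0); split; last by rewrite /= /b subrr mulr0 expR0 mulr1 subr_le0.
  by split; rewrite /= in_itv /= ?lexx ?sT.
have fstc : {within Q `&` [set p | g p.1 p.2 - b p.1 <= 0], continuous (fst : R * R -> R)}.
  by apply: continuous_subspaceT => p; exact: cvg_fst.
have [[t0 th1] + tmax] := compact_EVT_max D0 Dc fstc.
rewrite inE => -[[]]; rewrite /= !in_itv /= => /andP[st0 t0T] th1a; rewrite subr_le0 => gb1.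
have gth t : s <= t <= T -> {within `[- a, a], continuous (g t)}.
  move=> tsT; apply/subspace_continuousP => th tha.
  have Qp : Q (t, th) by split => //=; rewrite in_itv.
  move/subspace_continuousP : (gc) => /(_ (t, th) Qp) h U /h.
  rewrite !nbhs_simpl /within /= => -[[U1 U2]] /= [n1 n2] hU.
  apply: filterS n2 => th' hth' Ith'; apply: (hU (t, th')).
    by split => //=; exact: nbhs_singleton.
  by split => //=; rewrite in_itv.
have aa : - a <= a by case/andP : th0a => /le_trans; apply.
have [th tha thmin] := EVT_min aa (gth t0 (introT andP (conj st0 t0T))).
have {}thmin th' : - a <= th' <= a -> g t0 th <= g t0 th'.
  by move=> h; apply: thmin; rewrite in_itv.
move: tha; rewrite in_itv /= => tha.
have gb : g t0 th <= b t0 by apply: le_trans gb1; exact: thmin.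
move: t0T; rewrite le_eqVlt => /predU1P[t0T|t0T]; first by exists th; split; rewrite -?t0T.
exfalso.
suff [t [tt0 tT gbt]] : exists t, [/\ t0 < t, t < T & g t th < b t].
  have : t <= t0; last by rewrite leNgt tt0.
  apply: (tmax (t, th)); rewrite inE; split; last by rewrite /= subr_le0 ltW.
  split; rewrite /= in_itv /= ?tha //; apply/andP.
  by split; [exact: le_trans st0 (ltW tt0)|exact: ltW].
have rT : \forall t \near t0^'+, t0 < t /\ t < T.
  by apply: filterI; [exact: nbhs_right_gt|exact: nbhs_right_lt].
have [gblt|gbge] := ltP (g t0 th) (b t0).
  have qc : {within `[t0, T], continuous (fun t => g t th - b t)}.
    apply/subspace_continuousP => t /=; rewrite in_itv /= => /andP[t0t tT].
    have Qp : Q (t, th) by split => //=; rewrite in_itv /= ?tha // tT (le_trans st0).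
    move/subspace_continuousP : (gbc) => /(_ (t, th) Qp) h U /h.
    rewrite !nbhs_simpl /within /= => -[[U1 U2]] /= [n1 n2] hU.
    apply: filterS n1 => t' ht' Ith'; apply: (hU (t', th)).
      by split => //=; exact: nbhs_singleton.
    move: Ith'; rewrite in_itv /= => /andP[h1 h2].
    by split => //=; rewrite in_itv /= ?tha // h2 (le_trans st0).
  have [_ + _] := (continuous_within_itvP _ t0T).1 qc.
  move=> /cvgr_lt/(_ 0); rewrite subr_lt0 => /(_ gblt) h.
  have [t [[h1 h2] h3]] : exists t, (t0 < t /\ t < T) /\ g t th - b t < 0.
    by apply: (@filter_ex _ (t0^'+)); exact: filterI.
  by exists t; split => //; rewrite -subr_lt0.
have gE : g t0 th = b t0 by apply/eqP; rewrite eq_le gb.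
have g0 : 0 < g t0 th by rewrite gE.
have tsT : s <= t0 < T by rewrite st0.
have [d gd dlt] := crit t0 th tsT tha thmin g0.
have qd := is_deriveB gd (db t0).
have dneg : d - - mu * b t0 < 0 by rewrite subr_lt0 -gE.
have [t [[h1 h2] h3]] : exists t, (t0 < t /\ t < T) /\ (g^~ th - b) t < (g^~ th - b) t0.
  by apply: (@filter_ex _ (t0^'+)); apply: filterI => //; exact: neg_derive_right qd dneg.
exists t; split => //; move: h3; rewrite /= -[X in _ < X]/(g t0 th - b t0) gE subrr.
by rewrite -[X in X < _]/(g t th - b t) subr_lt0.
Qed.

End MinimalDecay.

(** * Synchronised solutions *)

Section Synchronisation.
Context {R : realType} {n : nat}.
Variables (K : set 'rV[R]_n) (f : 'rV[R]_n -> 'rV[R]_n).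
Variables (V : 'rV[R]_n -> 'rV[R]_n -> R) (lambda : R).
Variables (phi : 'rV[R]_n -> R -> 'rV[R]_n).
Hypotheses (VF : finsler_metric K V) (phiP : semiflow K f phi).

Let W (p : 'rV[R]_n * 'rV[R]_n) : R := V p.1 p.2.

Definition gap (x y : 'rV[R]_n) (t th : R) : 'rV[R]_n := phi y (t + th) - phi x t.

Lemma flow_continuous_at a (t : R) : K a -> 0 < t -> {for t, continuous (phi a)}.
Proof.
move=> Ka t0; apply: differentiable_continuous; apply/derivable1_diffP.
by have [] := flow_derive phiP Ka t0.
Qed.

Lemma finsler_within (T : topologicalType) (D : set T) (h1 h2 : T -> 'rV[R]_n) :
  (forall p, D p -> [/\ K (h1 p), {for p, continuous h1} & {for p, continuous h2}]) ->
  {within D, continuous (fun p => V (h1 p) (h2 p))}.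
Proof.
move=> h; apply/subspace_continuousP => p Dp; have [Kp c1 c2] := h p Dp.
have Kp' : (K `*` setT) (h1 p, h2 p) by [].
move/subspace_continuousP : (finsler_continuous VF) => /(_ _ Kp') hc U /hc.
rewrite !nbhs_simpl /within /= => -[[U1 U2]] /= [n1 n2] hU.
have m1 : nbhs p (h1 @^-1` U1) by exact: c1.
have m2 : nbhs p (h2 @^-1` U2) by exact: c2.
apply: filterS2 m1 m2 => q q1 q2 Dq; apply: (hU (h1 q, h2 q)) => //=.
by have [] := h q Dq.
Qed.

Lemma gap_continuous x y (s T a : R) : K x -> K y -> 0 < s -> a < s ->
  {within `[s, T] `*` `[- a, a],
    continuous (fun p : R * R => V (phi x p.1) (gap x y p.1 p.2))}.
Proof.
move=> Kx Ky s0 sa; apply: finsler_within => -[t th] [] /=.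
rewrite !in_itv /= => /andP[st _] /andP[ath _].
have t0 : 0 < t by exact: lt_le_trans st.
have c1 : {for (t, th), continuous (fun p : R * R => phi x p.1)}.
  apply: (@continuous_comp _ _ _ (fst : R * R -> R) (phi x)); first exact: cvg_fst.
  exact: flow_continuous_at.
split; [exact: (flow_in phiP Kx (ltW t0))|exact: c1|].
apply: continuousB; last exact: c1.
apply: (@continuous_comp _ _ _ (fun p : R * R => p.1 + p.2) (phi y)).
  exact: add_continuous.
by apply: flow_continuous_at => //=; lra.
Qed.

Lemma gap_derive_time x y (t th : R) : K x -> K y -> 0 < t -> 0 < t + th ->
  gap x y t th != 0 ->
  is_derive t 1 (fun s => V (phi x s) (gap x y s th))
    ('d W (phi x t, gap x y t th) (f (phi x t), f (phi y (t + th)) - f (phi x t))).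
Proof.
move=> Kx Ky t0 tth0 d0.
have dx := flow_derive phiP Kx t0.
have dy : is_derive t 1 (fun s => phi y (s + th)) (f (phi y (t + th))).
  have := @is_derive_shiftl _ _ (phi y) th t (f (phi y (t + th))).
  rewrite addrC => /(_ (flow_derive phiP Ky tth0)).
  by congr is_derive; apply/funext => s; rewrite addrC.
apply: (is_derive_diff_comp (is_derive_pair dx (is_deriveB dy dx))).
by apply: (finsler_diff VF) => //; apply: (flow_in phiP) => //; exact: ltW.
Qed.

Lemma gap_derive_offset x y (t th : R) : K x -> K y -> 0 < t -> 0 < t + th ->
  gap x y t th != 0 ->
  is_derive th 1 (fun s => V (phi x t) (gap x y t s))
    ('d W (phi x t, gap x y t th) (0, f (phi y (t + th)))).
Proof.
move=> Kx Ky t0 tth0 d0.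
have dy := is_derive_shiftl (flow_derive phiP Ky tth0).
have dy' := is_deriveB dy (is_derive_cst (phi x t) th (1 : R)).
rewrite subr0 in dy'.
apply: (is_derive_diff_comp (is_derive_pair (is_derive_cst (phi x t) th (1 : R)) dy')).
by apply: (finsler_diff VF) => //; apply: (flow_in phiP) => //; exact: ltW.
Qed.

Section Decay.
Variables (rho : R).
Hypothesis contraction : forall x y,
  K° x -> K y -> x != y -> `|y - x| < rho ->
  'd W (x, y - x) (0, f y) = 0 \/ 'd W (x, y - x) (0, f x) = 0 ->
  'd W (x, y - x) (f x, f y - f x) < - (lambda / 2) * V x (y - x).

(** [minimal_decay] for the size of the gap between x at time t and y at time
    t + th.  Time starts at 1 so that t + th is positive for all offsets in the
    window: the solution from [y] has no past, and x at time t is in the interior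
    of [K]. *)
Lemma synchronised_decay x y (a T B : R) : K x -> K y -> 0 <= a < 1 -> 1 <= T ->
  0 < B -> V (phi x 1) (gap x y 1 0) <= B ->
  (forall t th, 1 <= t <= T -> - a <= th <= a ->
    (forall th', - a <= th' <= a ->
      V (phi x t) (gap x y t th) <= V (phi x t) (gap x y t th')) ->
    `|gap x y t th| < rho /\ (gap x y t th != 0 ->
      'd W (phi x t, gap x y t th) (0, f (phi y (t + th))) = 0 \/
      'd W (phi x t, gap x y t th) (0, f (phi x t)) = 0)) ->
  exists th, [/\ - a <= th <= a,
    forall th', - a <= th' <= a ->
      V (phi x T) (gap x y T th) <= V (phi x T) (gap x y T th') &
    V (phi x T) (gap x y T th) <= B * expR (- (lambda / 2) * (T - 1))].
Proof.
move=> Kx Ky /andP[a0 a1] T1 B0 gB crit.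
apply: (@minimal_decay _ (fun t th => V (phi x t) (gap x y t th)) a 1 T B (lambda / 2) 0) => //.
- exact: gap_continuous.
- by rewrite oppr_le0 a0.
move=> t th /andP[t1 tT] tha thmin g0.
have t1T : 1 <= t <= T by rewrite t1 ltW.
have t0 : 0 < t by exact: lt_le_trans t1.
have [small tr] := crit t th t1T tha thmin.
have Kxt := flow_interior phiP Kx t0.
have tth0 : 0 < t + th by move/andP: tha => [? _]; lra.
have Kyt := flow_in phiP Ky (ltW tth0).
have d0 : gap x y t th != 0.
  by apply: contraTneq g0 => ->; rewrite (finsler_zero VF) ?ltxx //; exact: interior_subset.
exists ('d W (phi x t, gap x y t th) (f (phi x t), f (phi y (t + th)) - f (phi x t))).
  exact: gap_derive_time.
apply: contraction => //; last exact: tr.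
by rewrite -subr_eq0 -oppr_eq0 opprB.
Qed.

End Decay.
End Synchronisation.

(** * Halving the distance of two solutions *)

Section StepConstants.
Context {R : realType}.

Lemma exp_small (mu C : R) : 0 < mu -> 0 < C ->
  exists2 T : R, 2 <= T & C * expR (- mu * (T - 1)) <= 2^-1.
Proof.
move=> mu0 C0; exists (2 + 2 * C / mu).
  by rewrite lerDl divr_ge0 // ?mulr_ge0 // ltW.
rewrite mulNr expRN ler_pdivrMr ?expR_gt0 //.
have -> : mu * (2 + 2 * C / mu - 1) = mu + 2 * C by field; rewrite gt_eqF.
have : 1 + (mu + 2 * C) <= expR (mu + 2 * C) by apply: expR_ge1Dx.
lra.
Qed.

Lemma small_radius (C D E a r s : R) : 0 < C -> 0 < D -> 0 < E ->
  0 < a -> 0 < r -> 0 < s ->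
  exists eps, [/\ 0 < eps, C * eps <= a, D * eps < r & E * eps <= s].
Proof.
move=> C0 D0 E0 a0 r0 s0.
exists (Num.min (a / C) (Num.min (r / 2 / D) (s / E))).
rewrite !lt_min !divr_gt0 //; split => //.
- by rewrite mulrC -ler_pdivlMr // ge_min lexx.
- apply: (@le_lt_trans _ _ (r / 2)); last by rewrite ltr_pdivrMr // ltr_pMr // ltr1n.
  by rewrite mulrC -ler_pdivlMr // !ge_min lexx orbT.
- by rewrite mulrC -ler_pdivlMr // !ge_min lexx !orbT.
Qed.

Lemma offset_time_gt0 (a t th : R) : a <= 2^-1 -> 1 <= t -> - a <= th -> 0 < t + th.
Proof. by move=> ? ? ?; lra. Qed.

Lemma half_le_sub (m a b c : R) : m <= a -> b <= m / 2 -> a - b <= c -> m / 2 <= c.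
Proof. by move=> ? ? ?; lra. Qed.

End StepConstants.

Section Step.
Context {R : realType} {n : nat}.
Variables (K : set 'rV[R]_n) (f : 'rV[R]_n -> 'rV[R]_n).
Variables (V : 'rV[R]_n -> 'rV[R]_n -> R) (lambda : R).
Variables (phi : 'rV[R]_n -> R -> 'rV[R]_n).
Hypotheses (fs : smooth K f) (Kc : compact K) (VF : finsler_metric K V).
Hypotheses (l0 : 0 < lambda) (VC : transverse_contraction f K V lambda).
Hypothesis phiP : semiflow K f phi.

(** The two kinds of reference points with which nearby solutions can be
    synchronised: equilibria, and points whose orbit stays away from equilibria. *)
Definition regular (m : R) (x : 'rV[R]_n) : Prop :=
  f x = 0 \/ forall t : R, 0 <= t -> m <= `|f (phi x t)|.

(** The window of offsets is {0} for an equilibrium and [- a0, a0] otherwise.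
    In the second case the gap at a minimising offset is at most the gap at
    offset 0, which is O(|y - x|); by [flow_escape] the offset itself is then
    O(|y - x|), hence interior to the window when |y - x| <= eps. *)
Lemma synchronised_step (m : R) : 0 < m -> exists T C eps : R,
  [/\ 2 <= T, 0 < C, 0 < eps, C * eps <= 2^-1 & forall x y, K x -> K y ->
    regular m x -> `|y - x| <= eps -> exists2 tau : R,
      `|tau - T| <= C * `|y - x| & `|phi y tau - phi x T| <= `|y - x| / 2].
Proof.
move=> m0.
have [M M0 fM] := bounded_on_compact fs Kc.
have [L L0 fL] := lipschitz_on_compact fs Kc.
have [c c0 cP] := finsler_norm_equiv Kc VF.
have [rho rho0 lc] := local_contraction fs Kc VF l0 VC.
have [E1 E11 E1P] := flow_lipschitz phiP L0 fL (@ler01 R).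
have E10 : 0 < E1 by apply: lt_le_trans E11.
have cE0 : 0 < c * (c * E1) by rewrite !mulr_gt0.
have mu0 : 0 < lambda / 2 by rewrite divr_gt0.
have [T T2 TP] := exp_small mu0 cE0.
have T0 : 0 <= T by apply: le_trans T2.
have T1 : 1 <= T by apply: le_trans T2; rewrite ler1n.
have [E E1' EP] := flow_lipschitz phiP L0 fL T0.
have E0 : 0 < E by apply: lt_le_trans E1'.
have m4 : 0 < m / 4 by rewrite divr_gt0.
pose D := c * (c * E).
have D0 : 0 < D by rewrite !mulr_gt0.
pose a0 := Num.min 2^-1 (m / 4 / (L * M)).
have a00 : 0 < a0 by rewrite lt_min invr_gt0 ltr0n /= divr_gt0 // mulr_gt0.
have a0h : a0 <= 2^-1 by rewrite ge_min lexx.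
have a0m : L * (M * a0) <= m / 4.
  by rewrite mulrA mulrC -ler_pdivlMr ?mulr_gt0 // ge_min lexx orbT.
pose C := (D + E) / (m / 4).
have C0 : 0 < C by rewrite divr_gt0 // addr_gt0.
have LE0 : 0 < L * E by rewrite mulr_gt0.
have a02 : 0 < a0 / 2 by rewrite divr_gt0.
have a0lt : a0 / 2 < a0 by rewrite ltr_pdivrMr // ltr_pMr // ltr1n.
have m2 : 0 < m / 2 by rewrite divr_gt0.
(* the three bounds on eps keep minimising offsets inside the window, the gap
   within reach of local_contraction, and the speed along y above m / 2 *)
have [eps [eps0 epsC epsD epsE]] := small_radius C0 D0 LE0 a02 rho0 m2.
exists T, C, eps; split => //.
  exact: le_trans epsC (le_trans (ltW a0lt) a0h).
move=> x y Kx Ky xreg yx.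
have [xy|xy] := eqVneq x y.
  by exists T; rewrite xy !subrr !normr0 ?mulr0 ?mul0r.
have r0 : 0 < `|y - x| by rewrite normr_gt0 subr_eq0 eq_sym.
pose B := c * (E1 * `|y - x|).
have B0 : 0 < B by rewrite !mulr_gt0.
have K1 t : 0 <= t -> K (phi x t) by exact: (flow_in phiP).
have g0 : V (phi x 1) (gap phi x y 1 0) <= B.
  apply: le_trans (cP _ _ (K1 1 ler01)).2 _; apply: ler_wpM2l; first exact: ltW.
  by rewrite /gap addr0; apply: E1P => //; rewrite ler01 lexx.
have gapt t : 1 <= t <= T -> `|gap phi x y t 0| <= E * `|y - x|.
  by move=> /andP[t1 tT]; rewrite /gap addr0; apply: EP => //; rewrite tT (le_trans _ t1).
have gap_min t th a : 0 <= a -> 1 <= t <= T ->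
    (forall th', - a <= th' <= a ->
      V (phi x t) (gap phi x y t th) <= V (phi x t) (gap phi x y t th')) ->
    `|gap phi x y t th| <= D * `|y - x|.
  move=> a1 tT thmin; have t0 : 0 <= t by case/andP : tT => t1 _; exact: le_trans t1.
  apply: le_trans (cP _ _ (K1 t t0)).1 _; rewrite -mulrA; apply: ler_wpM2l; first exact: ltW.
  apply: le_trans (thmin 0 _) _; first by rewrite oppr_le0 a1.
  apply: le_trans (cP _ _ (K1 t t0)).2 _; rewrite -mulrA; apply: ler_wpM2l; first exact: ltW.
  exact: gapt.
have small_gap t th a : 0 <= a -> 1 <= t <= T ->
    (forall th', - a <= th' <= a ->
      V (phi x t) (gap phi x y t th) <= V (phi x t) (gap phi x y t th')) ->
    `|gap phi x y t th| < rho.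
  move=> a1 tT thmin; apply: le_lt_trans (gap_min t th a a1 tT thmin) _.
  by apply: le_lt_trans epsD; apply: ler_wpM2l => //; exact: ltW.
have finish th : `|th| <= C * `|y - x| ->
    V (phi x T) (gap phi x y T th) <= B * expR (- (lambda / 2) * (T - 1)) ->
    exists2 tau : R, `|tau - T| <= C * `|y - x| & `|phi y tau - phi x T| <= `|y - x| / 2.
  move=> thC gT; exists (T + th); first by rewrite addrC addKr.
  apply: le_trans (cP _ (gap phi x y T th) (K1 T T0)).1 _.
  apply: (@le_trans _ _ (c * (B * expR (- (lambda / 2) * (T - 1))))).
    by apply: ler_wpM2l => //; exact: ltW.
  have -> : c * (B * expR (- (lambda / 2) * (T - 1))) =
    c * (c * E1) * expR (- (lambda / 2) * (T - 1)) * `|y - x| by rewrite /B; ring.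
  by rewrite [X in _ <= X]mulrC; apply: ler_wpM2r.
case: xreg => [fx|fm].
  have [||th []] := synchronised_decay VF phiP lc Kx Ky (a := 0) _ T1 B0 g0.
  - by rewrite lexx ltr01.
  - move=> t th tT; rewrite oppr0 => tha thmin; split.
      by apply: (small_gap t th 0) => // th'; rewrite oppr0; exact: thmin.
    move=> _; right; rewrite (flow_equilibrium phiP Kx fx).
      by rewrite fx; exact: linear0.
    by case/andP : tT => t1 _; exact: le_trans t1.
  rewrite oppr0 => /le_anti <- _ gT; apply: (finish 0) => //.
  by rewrite normr0 mulr_ge0 // ltW.
have offset t th : 1 <= t <= T -> - a0 <= th <= a0 ->
    (forall th', - a0 <= th' <= a0 ->
      V (phi x t) (gap phi x y t th) <= V (phi x t) (gap phi x y t th')) ->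
    `|th| <= C * `|y - x|.
  move=> tT tha thmin; have gD := gap_min t th a0 (ltW a00) tT thmin.
  have gE := gapt t tT; case/andP : tT => t1 tT.
  have t0 : 0 <= t by exact: le_trans t1.
  have tth0 : 0 <= t + th.
    by case/andP : tha => tha _; apply: ltW; exact: offset_time_gt0 a0h t1 tha.
  have fy : m / 2 <= `|f (phi y t)|.
    have h1 := fL _ _ (K1 t t0) (flow_in phiP Ky t0).
    have h2 : L * `|phi y t - phi x t| <= m / 2.
      apply: le_trans epsE; rewrite -mulrA; apply: ler_wpM2l; first exact: ltW.
      move: gE; rewrite /gap addr0 => /le_trans; apply; apply: ler_wpM2l => //; exact: ltW.
    have := lerB_dist (f (phi x t)) (f (phi x t) - f (phi y t)).
    rewrite opprB addrCA subrr addr0 distrC.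
    exact: half_le_sub (fm t t0) (le_trans h1 h2).
  have thM : L * (M * `|th|) <= m / 4.
    apply: le_trans a0m; apply: ler_wpM2l; first exact: ltW.
    by apply: ler_wpM2l; [exact: ltW|rewrite ler_norml].
  have esc := flow_escape phiP M0 fM L0 fL Ky t0 tth0 m0 fy thM.
  have -> : C * `|y - x| = (D + E) * `|y - x| / (m / 4) by rewrite /C mulrAC.
  rewrite (ler_pdivlMr _ _ m4) mulrC; apply: le_trans esc _.
  have -> : phi y (t + th) - phi y t = gap phi x y t th - gap phi x y t 0.
    by rewrite /gap addr0 opprB addrA subrK.
  by rewrite mulrDl; apply: le_trans (ler_normB _ _) _; exact: lerD.
have aa : 0 <= a0 < 1 by rewrite ltW //= (le_lt_trans a0h) // invf_lt1 ?ltr1n.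
have [|th []] := synchronised_decay VF phiP lc Kx Ky aa T1 B0 g0.
  move=> t th tT tha thmin; split; first exact: small_gap (ltW a00) tT thmin.
  move=> d0; left.
  have thC := offset t th tT tha thmin.
  have tha' : `|th| < a0.
    apply: le_lt_trans thC _; apply: (@le_lt_trans _ _ (C * eps)).
      by apply: ler_wpM2l => //; exact: ltW.
    exact: le_lt_trans epsC a0lt.
  case/andP : (tT) => t1 _.
  have t0 : 0 < t by exact: lt_le_trans t1.
  have tth0 : 0 < t + th by case/andP : tha => tha _; exact: offset_time_gt0 a0h t1 tha.
  apply: local_min_derive (gap_derive_offset VF phiP Kx Ky t0 tth0 d0) _.
  have : nbhs th [set s : R | - a0 < s < a0].
    have -> : [set s : R | - a0 < s < a0] = `]- a0, a0[%classic.
      by apply/seteqP; split => s /=; rewrite in_itv.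
    apply: open_nbhs_nbhs; split; first exact: interval_open.
    by rewrite /= in_itv /= -ltr_norml.
  apply: filterS => s /= /andP[s1 s2].
  by apply: thmin; apply/andP; split; exact: ltW.
move=> tha thmin gT; apply: (finish th) => //.
by apply: (offset T th) => //; rewrite T1 lexx.
Qed.

End Step.

(** * Attraction and recurrence *)

Section Attraction.
Context {R : realType} {n : nat}.
Variables (K : set 'rV[R]_n) (f : 'rV[R]_n -> 'rV[R]_n).
Variables (phi : 'rV[R]_n -> R -> 'rV[R]_n).
Hypotheses (fs : smooth K f) (Kc : compact K).
Hypothesis phiP : semiflow K f phi.

(** The distance from the solution issued from [q] to the forward orbit of [z]
    tends to 0. *)
Definition attracted (q z : 'rV[R]_n) : Prop :=
  forall e : R, 0 < e -> exists2 T : R, 0 <= T &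
    forall t : R, T <= t -> exists2 s : R, 0 <= s & `|phi q t - phi z s| < e.

Lemma continuous_dependence (T : R) : 0 <= T -> exists2 E : R, 1 <= E &
  forall a b t, K a -> K b -> 0 <= t <= T -> `|phi b t - phi a t| <= E * `|b - a|.
Proof.
by have [L L0 fL] := lipschitz_on_compact fs Kc; exact: flow_lipschitz phiP L0 fL T.
Qed.

Lemma pow_half_small (e : R) : 0 < e -> exists k, 2^-1 ^+ k < e.
Proof.
move=> e0; have [k _ kP] := near_infty_natSinv_expn_lt (PosNum e0).
by exists k; have := kP k (leqnn k); rewrite /= exprVn div1r.
Qed.

Lemma attracted_flow q z t : K q -> 0 <= t -> attracted (phi q t) z -> attracted q z.
Proof.
move=> Kq t0 a e e0; have [T T0 TP] := a e e0; exists (t + T); first exact: addr_ge0.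
move=> u tu; have uT : T <= u - t by lra.
have [s s0 sP] := TP (u - t) uT; exists s => //.
have u0 : 0 <= u - t by exact: le_trans uT.
by move: sP; rewrite (flow_add phiP) // [t + _]addrC subrK.
Qed.

Lemma attracted_orbit q z s : K z -> 0 <= s -> attracted q (phi z s) -> attracted q z.
Proof.
move=> Kz s0 a e e0; have [T T0 TP] := a e e0; exists T => // t Tt.
have [u u0 uP] := TP t Tt; exists (s + u); first exact: addr_ge0.
by move: uP; rewrite (flow_add phiP).
Qed.

Lemma regular_flow m x s : K x -> 0 <= s -> regular f phi m x -> regular f phi m (phi x s).
Proof.
move=> Kx s0 [fx|mx]; first by rewrite (flow_equilibrium phiP) //; left.
by right=> t t0; rewrite (flow_add phiP) //; apply: mx; exact: addr_ge0.
Qed.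

Section Return.
Variables (m T C eps : R).
Hypotheses (T2 : 2 <= T) (C0 : 0 < C) (eps0 : 0 < eps) (Ceps : C * eps <= 2^-1).
Hypothesis step : forall x y, K x -> K y -> regular f phi m x -> `|y - x| <= eps ->
  exists2 tau : R, `|tau - T| <= C * `|y - x| & `|phi y tau - phi x T| <= `|y - x| / 2.

Let T0 : 0 <= T. Proof. by apply: le_trans T2. Qed.

Lemma step_near x y : K x -> K y -> regular f phi m x -> `|y - x| <= eps ->
  exists tau : R, [/\ `|tau - T| <= C * `|y - x|, 1 <= tau <= T + 1 &
    `|phi y tau - phi x T| <= `|y - x| / 2].
Proof.
move=> Kx Ky xr yx; have [tau tauT tauP] := step Kx Ky xr yx.
exists tau; split => //.
have : C * `|y - x| <= C * eps by rewrite ler_pM2l.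
move=> /le_trans/(_ Ceps) h1; have h2 := T2.
by move: tauT; rewrite ler_norml => /andP[h3 h4]; apply/andP; split; lra.
Qed.

(** Each step takes a time between 1 and T + 1 on the clock of [y] and halves the
    distance to the orbit of [x], so k steps are completed before time
    k (T + 1); [E] accounts for the last incomplete step. *)
Lemma shadowing : exists2 E : R, 0 < E & forall x y k (t : R), K x -> K y ->
  regular f phi m x -> `|y - x| <= eps -> k%:R * (T + 1) <= t ->
  exists2 s : R, 0 <= s & `|phi y t - phi x s| <= E * 2^-1 ^+ k * `|y - x|.
Proof.
have T10 : 0 <= T + 1 by apply: addr_ge0.
have [E E1 EP] := continuous_dependence T10.
have E0 : 0 < E by apply: lt_le_trans E1.
exists (2 * E); first by rewrite mulr_gt0.
have short x y k (t : R) : K x -> K y -> 0 <= t -> t <= T + 1 -> k%:R * (T + 1) <= t ->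
    exists2 s : R, 0 <= s & `|phi y t - phi x s| <= 2 * E * 2^-1 ^+ k * `|y - x|.
  move=> Kx Ky t0 tT kt; exists t => //.
  apply: le_trans (EP _ _ _ Kx Ky _) _; first by rewrite t0 tT.
  apply: ler_wpM2r => //.
  have : (k <= 1)%N.
    rewrite -(ler_nat R).
    have : k%:R * (T + 1) <= 1 * (T + 1) by rewrite mul1r; apply: le_trans tT.
    by rewrite ler_pM2r //; apply: ltr_wpDl.
  by case: k {kt} => [_|[_|//]]; rewrite ?expr0 ?expr1; lra.
(* one step consumes at least one unit of time, hence induction on a bound of t *)
suff main N x y k (t : R) : t <= N%:R -> K x -> K y ->
    regular f phi m x -> `|y - x| <= eps -> k%:R * (T + 1) <= t ->
    exists2 s : R, 0 <= s & `|phi y t - phi x s| <= 2 * E * 2^-1 ^+ k * `|y - x|.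
  move=> x y k t; apply: (main (Num.truncn `|t|).+1).
  by apply: le_trans (ler_norm _) _; apply: ltW; exact: truncnS_gt.
elim: N x y k t => [|N IH] x y k t tN Kx Ky xr yx kt.
  have t0 : 0 <= t by apply: le_trans kt; rewrite mulr_ge0.
  by apply: short => //; apply: le_trans tN _; rewrite addr_ge0.
have t0 : 0 <= t by apply: le_trans kt; rewrite mulr_ge0.
have [tT|Tt] := leP t (T + 1); first exact: short.
have [tau [_ /andP[tau1 tauT] tauP]] := step_near Kx Ky xr yx.
have t1 : 0 <= t - tau by lra.
have tau0 : 0 <= tau by lra.
have [||||||s s0 sP] := IH (phi x T) (phi y tau) k.-1 (t - tau).
- by move: tN; rewrite -natr1; lra.
- exact: (flow_in phiP).
- exact: (flow_in phiP).
- exact: regular_flow.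
- by apply: le_trans tauP _; have := normr_ge0 (y - x); lra.
- case: k kt => [|k] kt /=; first by rewrite mul0r.
  by move: kt; rewrite -natr1 mulrDl mul1r; lra.
exists (T + s); first exact: addr_ge0.
move: sP; rewrite !(flow_add phiP) // [tau + _]addrC subrK => /le_trans; apply.
apply: (@le_trans _ _ (2 * E * 2^-1 ^+ k.-1 * (`|y - x| / 2))).
  by apply: ler_wpM2l => //; rewrite !mulr_ge0 // ?exprn_ge0 ?invr_ge0 // ltW.
case: k {kt} => [|k] /=.
  by rewrite expr0 mulr1; apply: ler_wpM2l; [rewrite mulr_ge0 // ltW|have := normr_ge0 (y - x); lra].
by rewrite exprS; apply: le_of_eq; ring.
Qed.

Lemma regular_attracts x y : K x -> K y -> regular f phi m x -> `|y - x| <= eps ->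
  attracted y x.
Proof.
move=> Kx Ky xr yx e e0; have [E E0 EP] := shadowing.
have Ee : 0 < E * eps by rewrite mulr_gt0.
have [k kP] := pow_half_small (divr_gt0 e0 Ee).
exists (k%:R * (T + 1)); first by rewrite mulr_ge0 // addr_ge0.
move=> t tT; have [s s0 sP] := EP x y k t Kx Ky xr yx tT.
exists s => //; apply: le_lt_trans sP _.
apply: (@le_lt_trans _ _ (E * 2^-1 ^+ k * eps)).
  by apply: ler_wpM2l => //; rewrite mulr_ge0 ?exprn_ge0 ?invr_ge0 // ltW.
by move: kP; rewrite ltr_pdivlMr // mulrCA mulrA.
Qed.

(** The corrections of the clock form a geometric series: their sum is at most
    2 C |y - x|. *)
Lemma iterated_step k x y : K x -> K y -> regular f phi m x -> `|y - x| <= eps ->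
  exists tau : R, [/\ 0 <= tau, `|tau - k%:R * T| <= 2 * C * `|y - x| &
    `|phi y tau - phi x (k%:R * T)| <= 2^-1 ^+ k * `|y - x|].
Proof.
elim: k x y => [|k IH] x y Kx Ky xr yx.
  exists 0; rewrite mul0r subrr normr0 (flow0 phiP) // (flow0 phiP) // expr0 mul1r lexx.
  by split => //; rewrite !mulr_ge0 // ltW.
have [tau [tauT /andP[tau1 _] tauP]] := step_near Kx Ky xr yx.
have tau0 : 0 <= tau by lra.
have [||||s [s0 sT sP]] := IH (phi x T) (phi y tau).
- exact: (flow_in phiP).
- exact: (flow_in phiP).
- exact: regular_flow.
- by apply: le_trans tauP _; have := normr_ge0 (y - x); lra.
have kT0 : 0 <= k%:R * T by rewrite mulr_ge0.
exists (tau + s); split; first exact: addr_ge0.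
- have -> : tau + s - k.+1%:R * T = (tau - T) + (s - k%:R * T) by rewrite -natr1; ring.
  apply: le_trans (ler_normD _ _) _.
  have : 2 * C * `|phi y tau - phi x T| <= 2 * C * (`|y - x| / 2).
    by apply: ler_wpM2l => //; rewrite mulr_ge0 // ltW.
  lra.
have -> : k.+1%:R * T = T + k%:R * T by rewrite -natr1; ring.
rewrite -!(flow_add phiP) //; apply: le_trans sP _.
rewrite exprS; have -> : 2^-1 * 2^-1 ^+ k * `|y - x| = 2^-1 ^+ k * (`|y - x| / 2) by ring.
by apply: ler_wpM2l => //; rewrite exprn_ge0 // invr_ge0.
Qed.


Lemma compact_recurrence (u : nat -> 'rV[R]_n) (e : R) : (forall k, K (u k)) -> 0 < e ->
  exists k1 k2, (k1 < k2)%N /\ `|u k2 - u k1| <= e.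
Proof.
move=> Ku e0.
have uK : (u @ \oo) K by exists 0%N => // k _; exact: Ku.
have [a [_ ca]] := Kc _ uK.
have nb : nbhs a (ball a (e / 2)) by apply: nbhsx_ballx; rewrite divr_gt0.
have tail N : exists2 k, (N <= k)%N & `|a - u k| < e / 2.
  have uN : (u @ \oo) [set v | exists2 k, (N <= k)%N & v = u k].
    by exists N => // k Nk; exists k.
  have [v [[k Nk ->]]] := ca _ _ uN nb.
  by rewrite -ball_normE => /= h; exists k.
have [k1 _ h1] := tail 0%N; have [k2 k12 h2] := tail k1.+1.
exists k1, k2; split => //.
have -> : u k2 - u k1 = (a - u k1) - (a - u k2) by rewrite opprB [RHS]addrC addrA subrK.
by apply: le_trans (ler_normB _ _) _; lra.
Qed.

Definition in_orbit_closure (p z : 'rV[R]_n) : Prop :=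
  forall e : R, 0 < e -> exists2 t : R, 0 <= t & `|phi p t - z| < e.

Lemma orbit_closure_compact p : compact (K `&` in_orbit_closure p).
Proof.
apply: compact_closedI => //.
have -> : in_orbit_closure p = closure [set phi p t | t in [set t : R | 0 <= t]].
  apply/seteqP; split => z zP.
    move=> B /nbhs_ballP[e /= e0 eB]; have [t t0 tz] := zP e e0.
    exists (phi p t); split; first by exists t.
    by apply: eB; rewrite -ball_normE /= distrC.
  move=> e e0; have [_ [[t t0 <-]]] := zP _ (nbhsx_ballx z _ e0).
  by rewrite -ball_normE /= distrC; exists t.
exact: closed_closure.
Qed.

Lemma orbit_closure_refl p t : 0 <= t -> in_orbit_closure p (phi p t).
Proof. by move=> t0 e e0; exists t => //; rewrite subrr normr0. Qed.

Lemma regular_orbit_closure p z : K p -> K z -> in_orbit_closure p z ->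
  (forall t, 0 <= t -> m <= `|f (phi p t)|) -> regular f phi m z.
Proof.
move=> Kp Kz pz pm; right=> t t0; rewrite leNgt; apply/negP => fm.
have [L L0 fL] := lipschitz_on_compact fs Kc.
have [E E1 EP] := continuous_dependence t0.
have E0 : 0 < E by apply: lt_le_trans E1.
have d0 : 0 < (m - `|f (phi z t)|) / (L * E).
  by rewrite divr_gt0 ?subr_gt0 // mulr_gt0.
have [s s0] := pz _ d0; rewrite ltr_pdivlMr ?mulr_gt0 // => sz.
have Ks := flow_in phiP Kp s0.
have h1 : `|f (phi (phi p s) t) - f (phi z t)| <= L * (E * `|phi p s - z|).
  apply: le_trans (fL _ _ (flow_in phiP Kz t0) (flow_in phiP Ks t0)) _.
  by apply: ler_wpM2l; [exact: ltW|apply: EP => //; rewrite t0 lexx].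
have h2 := pm (s + t) (addr_ge0 s0 t0); rewrite -(flow_add phiP) // in h2.
have h3 := lerB_dist (f (phi (phi p s) t)) (f (phi z t)).
have h4 : L * (E * `|phi p s - z|) = `|phi p s - z| * (L * E) by ring.
lra.
Qed.

(** Here y = phi x S is on the orbit of x.  After k steps the solutions are at
    w = phi x (k T) and at phi x (S + tau), which is phi w (S + tau - k T), and
    the return times S + tau - k T stay in [S - 1, S + 1].  So the infimum of
    |phi w th - w| over the closure of the orbit and these times is 0, and by
    compactness it is attained. *)
Lemma periodic_in_closure p : K p -> (forall t, 0 <= t -> m <= `|f (phi p t)|) ->
  exists z th, [/\ K z, 0 < th, phi z th = z, regular f phi m z & in_orbit_closure p z].
Proof.
move=> Kp pm.
have Ku (k : nat) : K (phi p (k%:R * 2)) by apply: (flow_in phiP) => //; exact: mulr_ge0.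
have [k1 [k2 [k12 close]]] := compact_recurrence Ku eps0.
pose x := phi p (k1%:R * 2); pose S := (k2 - k1)%:R * 2 : R.
have S2 : 2 <= S.
  by rewrite /S -[leLHS]mul1r ler_pM2r // ler1n subn_gt0.
have S0 : 0 <= S by apply: le_trans S2.
have Kx : K x by exact: Ku.
have yE : phi p (k2%:R * 2) = phi x S.
  rewrite /x (flow_add phiP) // ?mulr_ge0 //; congr (phi p _).
  by rewrite /S natrB ?(ltnW k12) //; ring.
rewrite yE -/x in close.
have xreg : regular f phi m x.
  by right=> t t0; rewrite /x (flow_add phiP) ?mulr_ge0 //; apply: pm; rewrite addr_ge0 ?mulr_ge0.
have ret k : exists w th, [/\ (K `&` in_orbit_closure p) w, S - 1 <= th <= S + 1 &
    `|phi w th - w| <= 2^-1 ^+ k * eps].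
  have Ky := flow_in phiP Kx S0.
  have [tau [tau0 tauT tauP]] := iterated_step k Kx Ky xreg close.
  have kT0 : 0 <= k%:R * T by rewrite mulr_ge0.
  have thS : S - 1 <= S + tau - k%:R * T <= S + 1.
    have : 2 * C * `|phi x S - x| <= 1.
      have : C * `|phi x S - x| <= C * eps by rewrite ler_pM2l.
      by move=> /le_trans/(_ Ceps) h; lra.
    move=> /(le_trans tauT); rewrite ler_norml => /andP[h1 h2].
    by apply/andP; split; lra.
  exists (phi x (k%:R * T)), (S + tau - k%:R * T); split => //.
    split; first exact: (flow_in phiP).
    rewrite /x (flow_add phiP) ?mulr_ge0 //; apply: orbit_closure_refl => //.
    by rewrite addr_ge0 ?mulr_ge0.
  have th0 : 0 <= S + tau - k%:R * T by case/andP : thS => h _; lra.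
  rewrite (flow_add phiP) // [k%:R * T + _]addrC subrK -(flow_add phiP) //.
  apply: le_trans tauP _; apply: ler_wpM2l; last exact: close.
  by apply: exprn_ge0; rewrite invr_ge0.
have cQ : compact ((K `&` in_orbit_closure p) `*` (`[S - 1, S + 1] : set R)).
  by apply: compact_setX; [exact: orbit_closure_compact|exact: segment_compact].
have [M M0 fM] := bounded_on_compact fs Kc.
have S10 : 0 <= S + 1 by lra.
have [E E1 EP] := continuous_dependence S10.
have E0 : 0 < E by apply: lt_le_trans E1.
have hc : {within (K `&` in_orbit_closure p) `*` (`[S - 1, S + 1] : set R),
    continuous (fun q : 'rV[R]_n * R => `|phi q.1 q.2 - q.1| : R)}.
  apply/subspace_continuousP => -[w th] [/= [Kw _]]; rewrite in_itv /= => /andP[th1 th2].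
  apply/cvgrPdist_lt => e e0.
  have de0 : 0 < e / (E + M + 1) by rewrite divr_gt0 // !addr_gt0.
  have n1 : \forall q \near (w, th), `|w - q.1| < e / (E + M + 1).
    have c1 : {for (w, th), continuous (fst : 'rV[R]_n * R -> 'rV[R]_n)} by exact: cvg_fst.
    by have /cvgrPdist_lt/(_ _ de0) := c1.
  have n2 : \forall q \near (w, th), `|th - q.2| < e / (E + M + 1).
    have c2 : {for (w, th), continuous (snd : 'rV[R]_n * R -> R)} by exact: cvg_snd.
    by have /cvgrPdist_lt/(_ _ de0) := c2.
  rewrite near_withinE; apply: filterS2 n1 n2 => -[w' th'] /= h1 h2 [/= [Kw' _]].
  rewrite in_itv /= => /andP[th1' th2'].
  have th0 : 0 <= th by lra.
  have th0' : 0 <= th' by lra.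
  apply: le_lt_trans (ler_dist_dist _ _) _.
  have -> : phi w th - w - (phi w' th' - w') =
      (phi w th - phi w' th) + (phi w' th - phi w' th') - (w - w').
    by apply/rowP => i; rewrite !mxE; ring.
  apply: le_lt_trans (ler_normB _ _) _.
  have g1 := EP w' w th Kw' Kw (introT andP (conj th0 th2)).
  have g2 := flow_time_lipschitz phiP fM Kw' th0' th0.
  have g3 := ler_normD (phi w th - phi w' th) (phi w' th - phi w' th').
  have g4 : E * `|w - w'| <= E * (e / (E + M + 1)) by rewrite ler_pM2l // ltW.
  have g5 : M * `|th - th'| <= M * (e / (E + M + 1)) by rewrite ler_pM2l // ltW.
  have g6 : E * (e / (E + M + 1)) + M * (e / (E + M + 1)) + e / (E + M + 1) = e.
    by field; rewrite gt_eqF // !addr_gt0.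
  lra.
have Q0 : (K `&` in_orbit_closure p) `*` (`[S - 1, S + 1] : set R) !=set0.
  by have [w [th [wP thP _]]] := ret 0%N; exists (w, th); split => //=; rewrite in_itv.
have [[z th] + zmin] := compact_EVT_min Q0 cQ hc.
rewrite inE => -[/= [Kz pz]]; rewrite in_itv /= => /andP[th1 th2].
exists z, th; split => //; first by lra.
  apply/eqP; rewrite -subr_eq0 -normr_eq0 eq_le normr_ge0 andbT leNgt; apply/negP => v0.
  have [k kP] := pow_half_small (divr_gt0 v0 eps0).
  have [w [th' [wP thP wth]]] := ret k.
  have := zmin (w, th'); rewrite inE /= => h.
  have : `|phi z th - z| <= `|phi w th' - w| by apply: h; split => //=; rewrite in_itv.
  by move=> /le_trans/(_ wth); rewrite -ler_pdivrMr // leNgt kP.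
exact: regular_orbit_closure pz pm.
Qed.

End Return.
End Attraction.

(** * The attracting periodic orbit *)

Section PeriodicAttractor.
Context {R : realType} {n : nat}.
Variables (K : set 'rV[R]_n) (f : 'rV[R]_n -> 'rV[R]_n).
Variables (V : 'rV[R]_n -> 'rV[R]_n -> R) (lambda : R).
Variables (phi : 'rV[R]_n -> R -> 'rV[R]_n).
Hypotheses (fs : smooth K f) (Kc : compact K) (VF : finsler_metric K V).
Hypotheses (l0 : 0 < lambda) (VC : transverse_contraction f K V lambda).
Hypothesis phiP : semiflow K f phi.

Definition periodic_point (z : 'rV[R]_n) (th : R) : Prop :=
  [/\ K z, 0 < th & phi z th = z].

(** If the speed is not bounded below along the orbit of [p], its minimum over
    the closure of the orbit is 0: an equilibrium is a periodic point of any
    period. *)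
Lemma limit_periodic_point p : K p -> exists z th m, [/\ periodic_point z th,
  0 < m, regular f phi m z & in_orbit_closure phi p z].
Proof.
move=> Kp.
have [[m m0 pm]|nm] := pselect (exists2 m : R, 0 < m &
    forall t : R, 0 <= t -> m <= `|f (phi p t)|).
  have [T [C [eps [T2 C0 eps0 Ceps step]]]] := synchronised_step fs Kc VF l0 VC phiP m0.
  have [z [th [Kz th0 zth zr pz]]] :=
    periodic_in_closure fs Kc phiP T2 C0 eps0 Ceps step Kp pm.
  by exists z, th, m.
have fc : {within K `&` in_orbit_closure phi p, continuous (fun x => `|f x| : R)}.
  apply: continuous_in_subspaceT => x; rewrite inE => -[Kx _].
  apply: continuous_comp; last exact: norm_continuous.
  exact: differentiable_continuous (nbhs_singleton (smooth_differentiable fs Kx)).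
have C0 : K `&` in_orbit_closure phi p !=set0.
  exists (phi p 0); split; first exact: (flow_in phiP).
  exact: orbit_closure_refl.
have [z + zmin] := compact_EVT_min C0 (orbit_closure_compact Kc (p := p)) fc.
rewrite inE => -[Kz pz].
have fz : f z = 0.
  apply/eqP; rewrite -normr_eq0 eq_le normr_ge0 andbT leNgt; apply/negP => fz0.
  apply: nm; exists (`|f z|) => // t t0; apply: zmin; rewrite inE; split.
    exact: (flow_in phiP).
  exact: orbit_closure_refl.
exists z, 1, 1; split => //; last by left.
by split => //; exact: (flow_equilibrium phiP).
Qed.

Lemma local_attractor p : K p -> exists z th r, [/\ periodic_point z th, 0 < r &
  forall q, K q -> `|q - p| < r -> attracted phi q z].
Proof.
move=> Kp; have [z [th [m [zth m0 zr pz]]]] := limit_periodic_point Kp.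
have [T [C [eps [T2 C0 eps0 Ceps step]]]] := synchronised_step fs Kc VF l0 VC phiP m0.
have [Kz th0 zE] := zth.
have e2 : 0 < eps / 2 by rewrite divr_gt0.
have [t t0 tz] := pz _ e2.
have [E E1 EP] := continuous_dependence fs Kc phiP t0.
have E0 : 0 < E by apply: lt_le_trans E1.
exists z, th, (eps / 2 / E); split => //; first by rewrite divr_gt0.
move=> q Kq; rewrite ltr_pdivlMr // mulrC => qp.
apply: (attracted_flow phiP Kq t0).
apply: (regular_attracts fs Kc phiP T2 C0 eps0 Ceps step Kz) => //.
  exact: (flow_in phiP).
have -> : phi q t - z = (phi q t - phi p t) + (phi p t - z) by rewrite addrA subrK.
apply: le_trans (ler_normD _ _) _.
have := EP p q t Kp Kq; rewrite t0 lexx => /(_ isT) h; lra.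
Qed.

Lemma periodic_reduce z th (s : R) : periodic_point z th -> 0 <= s ->
  exists2 r : R, 0 <= r <= th & phi z s = phi z r.
Proof.
move=> [Kz th0 zE] s0.
have [N sN] : exists N, s <= N%:R * th.
  exists (Num.truncn (s / th)).+1; rewrite -ler_pdivrMr //; apply: ltW; exact: truncnS_gt.
elim: N s s0 sN => [|N IH] s s0 sN.
  exists 0; first by rewrite lexx ltW.
  by congr (phi z _); apply/eqP; rewrite eq_le s0 andbT; rewrite mul0r in sN.
have [sth|ths] := leP s th; first by exists s => //; rewrite s0.
have [||r rth rE] := IH (s - th); [lra|by move: sN; rewrite -natr1 mulrDl mul1r; lra|].
exists r => //; rewrite -rE -{2}zE (flow_add phiP) //; [|exact: ltW|by lra].
by rewrite addrC subrK.
Qed.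

(** At a late time the solution from [q] is close to both orbits.  Flowing for
    the remaining fraction of a period of [z'], a bounded time, moves the nearby
    point of the second orbit to [z'] itself, so [z'] is a limit of points of the
    first orbit, which is compact. *)
Lemma common_limit q z z' th th' : K q -> periodic_point z th -> periodic_point z' th' ->
  attracted phi q z -> attracted phi q z' -> exists2 s : R, 0 <= s & z' = phi z s.
Proof.
move=> Kq zth zth' qz qz'; have [Kz th0 zE] := zth; have [Kz' th0' zE'] := zth'.
have [M M0 fM] := bounded_on_compact fs Kc.
have hc : {within `[0, th], continuous (fun s : R => `|phi z s - z'| : R)}.
  apply/subspace_continuousP => s; rewrite /= in_itv /= => /andP[s0 _].
  apply/cvgrPdist_lt => e e0.
  have de0 : 0 < e / M by rewrite divr_gt0.
  have n1 : \forall u \near s, `|s - u| < e / M.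
    by have /cvgrPdist_lt/(_ _ de0) := @cvg_id _ (nbhs s).
  rewrite near_withinE; apply: filterS n1 => u us; rewrite /= in_itv /= => /andP[u0 _].
  apply: le_lt_trans (ler_dist_dist _ _) _.
  rewrite opprB addrA subrK; apply: le_lt_trans (flow_time_lipschitz phiP fM Kz u0 s0) _.
  by rewrite mulrC -ltr_pdivlMr.
have [s] := EVT_min (ltW th0) hc; rewrite in_itv /= => /andP[s0 _] smin.
exists s => //; apply/esym/eqP; rewrite -subr_eq0 -normr_eq0 eq_le normr_ge0 andbT.
rewrite leNgt; apply/negP => v0.
have [E E1 EP] := continuous_dependence fs Kc phiP (ltW th0').
have E0 : 0 < E by apply: lt_le_trans E1.
have e0 : 0 < `|phi z s - z'| / (2 * E) by rewrite divr_gt0 // mulr_gt0.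
have [T T0 TP] := qz _ e0; have [T' T0' TP'] := qz' _ e0.
pose t := Num.max T T'.
have [u u0 uP] := TP t (ltac:(by rewrite le_max lexx)).
have [u' u0' uP'] := TP' t (ltac:(by rewrite le_max lexx orbT)).
have [r /andP[r0 rth] rE] := periodic_reduce zth' u0'.
have d0 : 0 <= th' - r by rewrite subr_ge0.
have close : `|phi z (u + (th' - r)) - z'| < `|phi z s - z'|.
  have z'E : z' = phi (phi z' u') (th' - r).
    by rewrite rE (flow_add phiP) // addrC subrK.
  rewrite {1}z'E.
  rewrite -(flow_add phiP) //.
  apply: le_lt_trans (EP (phi z' u') (phi z u) (th' - r) _ _ _) _.
  - exact: (flow_in phiP).
  - exact: (flow_in phiP).
  - by rewrite d0 /= gerBl.
  have -> : phi z u - phi z' u' = (phi q t - phi z' u') - (phi q t - phi z u).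
    by rewrite opprB [RHS]addrC addrA subrK.
  have := ler_normB (phi q t - phi z' u') (phi q t - phi z u) => h.
  apply: (@le_lt_trans _ _ (E * (`|phi q t - phi z' u'| + `|phi q t - phi z u|))).
    by rewrite ler_pM2l.
  have E20 : 0 < 2 * E by rewrite mulr_gt0.
  move: uP uP'; rewrite !(ltr_pdivlMr _ _ E20).
  move: (`|phi q t - phi z' u'|) (`|phi q t - phi z u|) (`|phi z s - z'|) => A B v.
  lra.
have u1 : 0 <= u + (th' - r) by exact: addr_ge0.
have [w wth wE] := periodic_reduce zth u1.
move: close; rewrite wE ltNge => /negP; apply; apply: smin; by rewrite in_itv.
Qed.

Lemma limit_transfer q z z' th th' b : K q -> periodic_point z th ->
  periodic_point z' th' -> attracted phi q z -> attracted phi q z' ->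
  attracted phi b z' -> attracted phi b z.
Proof.
move=> Kq zth zth' qz qz'; have [s s0 ->] := common_limit Kq zth zth' qz qz'.
by have [Kz _ _] := zth; exact: (attracted_orbit phiP Kz s0).
Qed.

(** By compactness of [0, 1] there is one d such that any d-interval of
    parameters is attracted to one periodic orbit; by [common_limit] neighbouring
    intervals have the same orbit. *)
Lemma attracted_along_path z th (g : R -> 'rV[R]_n) :
  periodic_point z th -> smooth (`[0, 1] : set R) g ->
  (forall s : R, 0 <= s <= 1 -> K (g s)) -> attracted phi (g 0) z ->
  attracted phi (g 1) z.
Proof.
move=> zth gs gK g0.
have : \forall d \near (0 : R)^'+, (`[0, 1] : set R) `<=` [set s : R |
    exists w th', periodic_point w th' /\ forall s' : R, 0 <= s' <= 1 -> `|s' - s| < d ->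
      attracted phi (g s') w].
  have /compact_near_coveringP := @segment_compact R 0 1; apply => s s01.
  have Ks : K (g s) by apply: gK; move: s01; rewrite /= in_itv.
  have [w [th' [r [wth r0 rP]]]] := local_attractor Ks.
  have gc : {for s, continuous g}.
    exact: differentiable_continuous (nbhs_singleton (smooth_differentiable gs s01)).
  have /cvgrPdist_lt/(_ _ r0)/nbhs_ballP[d /= d0 dP] := gc.
  have d20 : 0 < d / 2 by rewrite divr_gt0.
  exists (ball s (d / 2), [set e : R | 0 < e /\ e < d / 2]).
    split; first exact: nbhsx_ballx.
    by apply: filterI; [exact: nbhs_right_gt|exact: nbhs_right_lt].
  case=> s1 e [] /=; rewrite -ball_normE /= => ss1 [e0 ed].
  exists w, th'; split => // s' s'01 s's1; apply: rP; first exact: gK.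
  rewrite distrC; apply: dP; rewrite -ball_normE /=.
  have -> : s - s' = (s - s1) - (s' - s1) by rewrite opprB addrA subrK.
  by apply: le_lt_trans (ler_normB _ _) _; lra.
rewrite near_withinE => /nbhs_ballP[d' /= d'0 dP'].
have [d d0 dP] : exists2 d : R, 0 < d & forall s : R, 0 <= s <= 1 ->
    exists w th', periodic_point w th' /\ forall s' : R, 0 <= s' <= 1 -> `|s' - s| < d ->
      attracted phi (g s') w.
  have d20 : 0 < d' / 2 by rewrite divr_gt0.
  exists (d' / 2) => // s s01.
  have db : ball (0 : R) d' (d' / 2).
    by rewrite -ball_normE /= sub0r normrN gtr0_norm //; lra.
  have := dP' (d' / 2) db d20 s; rewrite /= in_itv => h; exact: h.
have d20 : 0 < d / 2 by rewrite divr_gt0.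
suff main N (s : R) : 0 <= s <= 1 -> s <= N%:R * (d / 2) -> attracted phi (g s) z.
  apply: (main (Num.truncn (1 / (d / 2))).+1); first by rewrite ler01 lexx.
  rewrite -ler_pdivrMr //; apply: ltW; exact: truncnS_gt.
elim: N s => [|N IH] s s01 sN.
  have -> // : s = 0.
  by apply/eqP; rewrite eq_le; case/andP : s01 => -> _; rewrite andbT; rewrite mul0r in sN.
pose s1 := Num.max 0 (s - d / 2).
have [s0 s1'] := andP s01.
have s11 : 0 <= s1 <= 1 /\ `|s - s1| < d.
  rewrite /s1; have [h|h] := leP 0 (s - d / 2).
    by rewrite opprB addrCA subrr addr0 gtr0_norm //; split; [apply/andP; split|]; lra.
  by rewrite subr0 ger0_norm // lexx ler01; split => //; lra.
have [s101 ss1] := s11.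
have g1 : attracted phi (g s1) z.
  apply: IH => //; rewrite /s1 ge_max; apply/andP; split.
    by rewrite mulr_ge0 // ltW.
  by move: sN; rewrite -natr1 mulrDl mul1r; lra.
have [w [th' [wth wP]]] := dP s1 s101.
apply: (limit_transfer (gK _ s101) zth wth g1).
  by apply: wP => //; rewrite subrr normr0.
exact: wP.
Qed.

End PeriodicAttractor.

(** * The periodic orbit as a solution on the whole line *)

Section PeriodicOrbit.
Context {R : realType} {n : nat}.
Variables (K : set 'rV[R]_n) (f : 'rV[R]_n -> 'rV[R]_n).
Variables (phi : 'rV[R]_n -> R -> 'rV[R]_n).
Hypothesis phiP : semiflow K f phi.
Variables (z : 'rV[R]_n) (th : R).
Hypothesis zth : periodic_point K phi z th.

(** [phi z] is known for nonnegative times only; the number of periods added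
    makes the argument nonnegative. *)
Definition periodic_extension (t : R) : 'rV[R]_n :=
  phi z (t + (Num.truncn (`|t| / th)).+1%:R * th).

Let Kz : K z. Proof. by case: zth. Qed.
Let th0 : 0 < th. Proof. by case: zth. Qed.

Lemma period_shift (t : R) k : 0 <= t -> phi z (t + k%:R * th) = phi z t.
Proof.
move=> t0; elim: k => [|k IH]; first by rewrite mul0r addr0.
have [_ th00 zE] := zth.
have kt : 0 <= t + k%:R * th by rewrite addr_ge0 // mulr_ge0 // ltW.
have -> : t + k.+1%:R * th = th + (t + k%:R * th) by rewrite -natr1; ring.
by rewrite -(flow_add phiP) // ?zE // ltW.
Qed.

Lemma periodic_extensionE (t : R) k : 0 <= t + k%:R * th ->
  periodic_extension t = phi z (t + k%:R * th).
Proof.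
move=> tk; rewrite /periodic_extension; set N := (Num.truncn _).+1.
have tN : 0 <= t + N%:R * th.
  have : `|t| / th <= N%:R by apply: ltW; exact: truncnS_gt.
  rewrite ler_pdivrMr // => h; have := ler_norm (- t); rewrite normrN; lra.
rewrite -(period_shift k tN) -(period_shift N tk); congr (phi z _); ring.
Qed.

Lemma periodic_extension_ge0 (t : R) : 0 <= t -> periodic_extension t = phi z t.
Proof. by move=> t0; rewrite (@periodic_extensionE t 0) mul0r addr0. Qed.

Lemma far_period (t c : R) : exists k, c <= t + k%:R * th.
Proof.
exists (Num.truncn (`|c - t| / th)).+1.
have : `|c - t| / th <= (Num.truncn (`|c - t| / th)).+1%:R by apply: ltW; exact: truncnS_gt.
by rewrite ler_pdivrMr // => h; have := ler_norm (c - t); lra.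
Qed.

Lemma periodic_extension_derive (t : R) :
  is_derive t 1 periodic_extension (f (periodic_extension t)).
Proof.
have [k tk] := far_period t 1.
have tk0 : 0 < t + k%:R * th by exact: lt_le_trans tk.
have d : is_derive t 1 (fun s => phi z (s + k%:R * th)) (f (phi z (t + k%:R * th))).
  have := @is_derive_shiftl _ _ (phi z) (k%:R * th) t (f (phi z (t + k%:R * th))).
  rewrite addrC => /(_ (flow_derive phiP Kz tk0)).
  by congr is_derive; apply/funext => s; rewrite addrC.
rewrite (periodic_extensionE (ltW tk0)); apply: near_eq_is_derive d.
have : nbhs t (ball t 1) by exact: nbhsx_ballx.
apply: filterS => s; rewrite -ball_normE /= => ts; apply/esym/periodic_extensionE.
by move: ts; rewrite ltr_norml => /andP[_ h]; lra.
Qed.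

Lemma periodic_extension_orbit : periodic_orbit f (range periodic_extension).
Proof.
exists periodic_extension, th; split => //; last first.
  move=> t; have [k tk] := far_period t 0.
  rewrite (periodic_extensionE tk) -(period_shift 1 tk) mul1r.
  have e : t + k%:R * th + th = t + th + k%:R * th by ring.
  by rewrite e; apply: periodic_extensionE; rewrite -e addr_ge0 // ltW.
split; last by move=> t _; exact: periodic_extension_derive.
apply: continuous_subspaceT => t; apply: differentiable_continuous.
by apply/derivable1_diffP; have [] := periodic_extension_derive t.
Qed.

Lemma periodic_extension_in : range periodic_extension `<=` K.
Proof.
move=> _ [t _ <-]; have [k tk] := far_period t 0.
by rewrite (periodic_extensionE tk); exact: (flow_in phiP).
Qed.

End PeriodicOrbit.

Lemma edist_inf_cvg0 (R : realType) (n : nat) (X : set 'rV[R]_n) (x : R -> 'rV[R]_n) :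
  (forall e : R, 0 < e -> exists2 T : R, 0 <= T &
    forall t, T <= t -> exists2 a, X a & `|x t - a| < e) ->
  edist_inf X (x t) @[t --> +oo] --> (0 : \bar R)%E.
Proof.
move=> h.
have le_e (e : R) : 0 < e -> \forall t \near +oo, (edist_inf X (x t) < e%:E)%E.
  move=> e0; have e20 : 0 < e / 2 by rewrite divr_gt0.
  have [T T0 TP] := h _ e20.
  apply: filterS (nbhs_pinfty_ge (num_real T)) => t Tt.
  have [a Xa xa] := TP t Tt.
  apply: (@le_lt_trans _ _ (edist (x t, a))); first by apply: ereal_inf_lbound; exists a.
  apply: (@le_lt_trans _ _ (e / 2)%:E); last by rewrite lte_fin; lra.
  by apply: edist_fin => //=; rewrite -ball_normE.
apply: cvg_EFin.
  apply: filterS (le_e 1 ltr01) => t h1.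
  by rewrite ge0_fin_numE ?edist_inf_ge0 //; exact: lt_trans h1 (ltry _).
apply/cvgrPdist_lt => e e0; apply: filterS (le_e e e0) => t h1.
rewrite sub0r normrN ger0_norm ?fine_ge0 ?edist_inf_ge0 //=.
rewrite -lte_fin fineK // ge0_fin_numE ?edist_inf_ge0 //; exact: lt_trans h1 (ltry _).
Qed.

Unset Implicit Arguments.

Theorem theorem2 (R : realType) (n : nat) (K : set 'rV[R]_n)
    (f : 'rV[R]_n -> 'rV[R]_n)
    (f_smooth : smooth K f)
    (f_sol : solutions_exist_unique f K)
    (K_nonempty : K !=set0)
    (K_compact : compact K)
    (K_connected : smoothly_path_connected K)
    (K_invariant : strictly_forward_invariant f K)
    (lambda : R) (V : 'rV[R]_n -> 'rV[R]_n -> R)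
    (lambda_pos : 0 < lambda)
    (V_finsler : finsler_metric K V)
    (V_contraction : transverse_contraction f K V lambda) :
  exists! X : set 'rV[R]_n,
    [/\ periodic_orbit f X, X `<=` K &
        forall x : R -> 'rV[R]_n, solution f `[0, +oo[ x -> K (x 0) ->
          edist_inf X (x t) @[t --> +oo] --> (0 : \bar R)%E].
Proof.
have [phi phiP phiE] := semiflow_exists f_sol K_invariant.
have [a Ka] := K_nonempty.
have [z [th [r [zth r0 zP]]]] :=
  local_attractor f_smooth K_compact V_finsler lambda_pos V_contraction phiP Ka.
have [Kz th0 zE] := zth.
have az : attracted phi a z by apply: zP => //; rewrite subrr normr0.
have all_attracted b : K b -> attracted phi b z.
  move=> Kb; have [g [gs g0 g1 gK]] := K_connected a b Ka Kb.
  rewrite -g1; apply: (attracted_along_path f_smooth K_compact V_finsler lambda_pos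
    V_contraction phiP zth gs gK).
  by rewrite g0.
pose X := range (periodic_extension phi z th).
have X_attracts x : solution f `[0, +oo[ x -> K (x 0) ->
    forall e : R, 0 < e -> exists2 T : R, 0 <= T &
    forall t, T <= t -> exists2 b, X b & `|x t - b| < e.
  move=> xs Kx e e0; have [T T0 TP] := all_attracted _ Kx e e0.
  exists T => // t Tt; have [s s0 sP] := TP t Tt.
  exists (phi z s); first by exists s => //; exact: (periodic_extension_ge0 phiP zth).
  by rewrite phiE //; exact: le_trans Tt.
exists X; split.
  split; first exact: (periodic_extension_orbit phiP zth).
    exact: (periodic_extension_in phiP zth).
  by move=> x xs Kx; apply/edist_inf_cvg0; exact: X_attracts.
(* uniqueness: y has itself and z as limits, so y 0 lies on the orbit of z *)
move=> X' [[y [T' [ys T'0 yT' ->]]] yK _].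
have ray : solution f `[0, +oo[ y by exact: solutionW ys.
have Ky0 : K (y 0) by apply: yK; exists 0.
have yE t : 0 <= t -> y t = phi (y 0) t by move=> t0; exact: phiE.
have y0th : periodic_point K phi (y 0) T'.
  by split => //; rewrite -yE ?ltW // -[X in y X = _]add0r yT'.
have aty : attracted phi (y 0) (y 0).
  move=> e e0; exists 0 => // t t0; exists t => //; by rewrite subrr normr0.
have [s s0 ysE] := common_limit f_smooth K_compact phiP Ky0 zth y0th
  (all_attracted _ Ky0) aty.
have yk t k : y (t + k%:R * T') = y t.
  elim: k => [|k IH]; first by rewrite mul0r addr0.
  by rewrite -natr1 mulrDl mul1r addrA yT'.
apply/seteqP; split => _ [t _ <-].
  have [k0 k0P] := far_period zth t 0.
  rewrite (periodic_extensionE phiP zth k0P).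
  have [k kP] := far_period zth (t + k0%:R * th) s.
  rewrite -(period_shift phiP zth k k0P).
  have d0 : 0 <= t + k0%:R * th + k%:R * th - s by rewrite subr_ge0.
  exists (t + k0%:R * th + k%:R * th - s) => //.
  by rewrite yE // ysE (flow_add phiP) // [s + _]addrC subrK.
have [k kP] := far_period y0th t 0.
exists (s + (t + k%:R * T')) => //.
rewrite (periodic_extension_ge0 phiP zth); last exact: addr_ge0.
by rewrite -(flow_add phiP) // -ysE -yE // yk.
Qed.
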